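(* Let $k\ge1$. The single-variable $\Gamma$-ordinary generating functions of the $\mathfrak S_k$-species $\mathcal{CT}_k^Y$ of $Y$-rooted $k$-coding trees and of the $\mathfrak S_{k+1}$-species $\mathcal{CT}_k^{XY}$ of edge-rooted $k$-coding trees are given by $$\widetilde{\mathcal{CT}^Y_k}(\lambda)(x)=\exp\Big(\sum_{n\ge1}\frac{x^n}{n}\prod_{i\in\lambda^n}\widetilde{\mathcal{CT}^Y_k}\big(\lambda^{ni}\big)\big(x^{ni}\big)\Big)\qquad(\lambda\vdash k)$$ and $$\widetilde{\mathcal{CT}^{XY}_k}(\lambda)(x)=x\cdot\prod_{i\in\lambda}\widetilde{\mathcal{CT}^Y_k}\big(\lambda^i-\{1\}\big)\big(x^i\big)\qquad(\lambda\vdash k+1),$$ where $\prod_{i\in\lambda}$ is a product over the parts $i$ of $\lambda$ taken with multiplicity, $\lambda^i$ denotes the cycle type of $\sigma^i$ for any permutation $\sigma$ of cycle type $\lambda$, $\lambda^i-\{1\}$ is $\lambda^i$ with one part equal to $1$ removed, and $f(\lambda)(x)$ denotes the value of $f(\sigma)(x)$ for any $\sigma$ of cycle type $\lambda$.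
   Context: **$k$-coding trees.** A $k$-coding tree is a finite tree with vertices colored black and white, each edge joining a black and a white vertex, in which every black vertex has exactly $k+1$ (white) neighbors and carries a cyclic ordering of them (white vertices may have any number of black neighbors; a single white vertex is allowed). $\mathcal{CT}_k$ is the two-sort species of $k$-coding trees with black vertices labeled by sort $X$ and white vertices by sort $Y$. $\mathcal{CT}_k^Y$ and $\mathcal{CT}_k^{XY}$ are the species of $k$-coding trees rooted at a white vertex and at an edge. **Actions.** $\mathfrak S_m$ is the symmetric group on $[m]=\{1,\dots,m\}$ and $\mathfrak S_k\subset\mathfrak S_{k+1}$ is the subgroup fixing $k+1$. For $\sigma\in\mathfrak S_{k+1}$, $i\in[k+1]$, let $\rho_i(\sigma)\in\mathfrak S_{k+1}$ be $a\mapsto\sigma(i+a)-\sigma(i)$, with sums and differences reduced modulo $k+1$ to representatives in $\{1,\dots,k+1\}$; $\rho_i(\sigma)$ fixes $k+1$. In a $\mathcal{CT}^Y_k$-structure, the cyclic order at each black vertex is linearized by putting its parent (the neighbor toward the root) last, in position $k+1$. Thus a $\mathcal{CT}_k^Y$-structure is a root label $y$ together with a set of structures $(x;W_1,\dots,W_k)$, with $x$ a black label and the $W_i$ $\mathcal{CT}_k^Y$-structures. Recursively, $\sigma\in\mathfrak S_k$ acts on a $\mathcal{CT}_k^Y$-structure by fixing $y$ and replacing each $(x;W_1,\dots,W_k)$ by $(x;W'_1,\dots,W'_k)$ with $W'_{\sigma(i)}=\rho_i(\sigma)\cdot W_i$. A $\mathcal{CT}^{XY}_k$-structure is written $(x;W_1,\dots,W_{k+1})$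 with $x$ the root black vertex, the $W_i$ $\mathcal{CT}_k^Y$-structures and the white vertex of the root edge being the root of $W_{k+1}$; $\sigma\in\mathfrak S_{k+1}$ sends it to $(x;W'_1,\dots,W'_{k+1})$ with $W'_{\sigma(i)}=\rho_i(\sigma)\cdot W_i$. These actions commute with relabeling, so they make $\mathcal{CT}_k^Y$ an $\mathfrak S_k$-species and $\mathcal{CT}_k^{XY}$ an $\mathfrak S_{k+1}$-species. **$\Gamma$-cycle index and $\Gamma$-generating function.** For a two-sort species $F$ with an action of a group $\Gamma$ commuting with relabelings and $\gamma\in\Gamma$, $$Z^\Gamma_F(\gamma)=\sum_{m,n\ge0}\frac1{m!\,n!}\sum_{\mu\in\mathfrak S_m,\nu\in\mathfrak S_n}\left|\mathrm{Fix}(\gamma\cdot F[\mu,\nu])\right|p_\mu[x]\,p_\nu[y],$$ with $p_\mu[x]=\prod_i p_i[x]^{\mu_i}$, $\mu_i$ the number of $i$-cycles of $\mu$ (similarly for $y$). The $\Gamma$-ordinary generating function $\widetilde F(\gamma)(x)$ is obtained from $Z_F^\Gamma(\gamma)$ by substituting $p_i[x]=x^i$, $p_i[y]=1$ for all $i\ge1$. It is a class function of $\gamma$, so it depends only on the cycle type when $\Gamma$ is a symmetric group. The cycle type of an element of $\mathfrak S_k$ is taken as a partition of $k$, that of an element of $\mathfrak S_{k+1}$ as a partition of $k+1$. *)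

(* Defs.v *)
From HB Require Import structures.
From mathcomp Require Import all_boot all_order all_fingroup all_algebra.
From mathcomp Require Import classical_sets fsbigop.

Set Implicit Arguments.
Unset Strict Implicit.
Unset Printing Implicit Defensive.

Import GRing.Theory.

Local Open Scope ring_scope.

(** * Two-sort species with a group action *)

(* The part of a two-sort Gamma-species that enters its cycle index: for
   finite sets B (sort X) and W (sort Y), the finite set [gstr B W] of
   structures inside an ambient finite type, the transport of structures along
   permutations of B and W, and the action of Gamma. *)
Record gspecies (Gamma : Type) := GSpecies {
  gcarrier : finType -> finType -> finType;
  gstr : forall B W : finType, {set gcarrier B W};
  gtransport : forall B W : finType,
    {perm B} -> {perm W} -> gcarrier B W -> gcarrier B W;
  gact : forall B W : finType, Gamma -> gcarrier B W -> gcarrier B W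
}.

(* Fix(gamma . F[mu, nu]) *)
Definition gfix (Gamma : Type) (F : gspecies Gamma) (g : Gamma) (m n : nat)
    (mu : 'S_m) (nu : 'S_n) : {set gcarrier F 'I_m 'I_n} :=
  [set s in gstr F 'I_m 'I_n | gact g (gtransport mu nu s) == s].

(* p_mu = prod_i p_i ^ mu_i, with mu_i the number of i-cycles of mu *)
Definition psum (R : comNzRingType) (p : nat -> R) (m : nat) (mu : 'S_m) : R :=
  \prod_(1 <= i < m.+1) p i ^+ #|[set C in porbits mu | #|C| == i]|.

(* The part of Z_F^Gamma(g) with indices m and n. It is a polynomial in the
   p_i[x], p_i[y] over the rationals, presented by its value at px, py in an
   arbitrary commutative Q-algebra. *)
Definition cycle_index (Gamma : Type) (F : gspecies Gamma) (g : Gamma)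
    (m n : nat) (R : comAlgType rat) (px py : nat -> R) : R :=
  ((m`!%:R * n`!%:R)^-1 : rat) *:
    \sum_(mu : 'S_m) \sum_(nu : 'S_n)
      (#|gfix F g mu nu|%:R * psum px mu * psum py nu).

(** * Formal power series over the rationals, as coefficient sequences *)

Definition fps := nat -> rat.

Definition fps_one : fps := fun m => (m == 0%N)%:R.

Definition fps_mul (f g : fps) : fps :=
  fun m => \sum_(i < m.+1) f i * g (m - i)%N.

Definition fps_scale (c : rat) (f : fps) : fps := fun m => c * f m.

(* x ^ d * f(x) *)
Definition fps_shift (d : nat) (f : fps) : fps :=
  fun m => if (d <= m)%N then f (m - d)%N else 0.

(* f(x ^ d), for d > 0 *)
Definition fps_dilate (d : nat) (f : fps) : fps :=
  fun m => if (d %| m)%N then f (m %/ d)%N else 0.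

(* The sum of a locally finite family: [\sum_(i \in A)] is the sum over the
   (finite) support, coefficient by coefficient. *)
Definition fps_sum (I : choiceType) (A : set I) (f : I -> fps) : fps :=
  fun m => \sum_(i \in A) f i m.

(* exp f = sum_j f ^ j / j!, for f with zero constant term *)
Definition fps_exp (f : fps) : fps :=
  fps_sum [set: nat]%classic
    (fun j => fps_scale (j`!%:R^-1) (iter j (fps_mul f) fps_one)).

(* p_i[x] := x ^ i and p_i[y] := 1 in the Gamma-cycle index *)
Definition ogf (Gamma : Type) (F : gspecies Gamma) (g : Gamma) : fps :=
  fps_sum [set: nat * nat]%classic
    (fun mn j => (cycle_index F g mn.1 mn.2
                    (fun i => 'X^i : {poly rat}) (fun=> 1))`_j).

(** * Partitions and cycle types *)

Definition is_partition (k : nat) (la : seq nat) : bool :=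
  [&& sorted geq la, 0%N \notin la & sumn la == k].

Definition cycle_type (k : nat) (s : 'S_k) : seq nat :=
  sort geq [seq #|C| | C : {set 'I_k} in porbits s].

(** * The maps rho_i *)

(* The positions 1, ..., k+1 are the residues modulo k+1, i.e. the elements of
   the additive group 'I_k.+1; position k+1 is the residue 0. *)

Definition rho_fun (k : nat) (i : 'I_k.+1) (s : 'S_k.+1) (a : 'I_k.+1) :=
  s (i + a) - s i.

Lemma rho_fun_inj (k : nat) (i : 'I_k.+1) (s : 'S_k.+1) :
  injective (rho_fun i s).
Proof. by move=> a b /addIr /perm_inj /addrI. Qed.

Definition rho (k : nat) (i : 'I_k.+1) (s : 'S_k.+1) : 'S_k.+1 :=
  perm (@rho_fun_inj k i s).

(* S_k as the subgroup of S_{k+1} fixing k+1: the element j of 'I_k stands for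
   j+1 in [k], which is the residue [lift ord0 j]. *)
Definition embed (k : nat) (s : 'S_k) : 'S_k.+1 := lift_perm ord0 ord0 s.

(** * Trees *)

(* A cycle of a simple graph is a cyclic sequence of at least 3 distinct
   vertices; its length is at most #|T|. *)
Definition is_tree (T : finType) (e : rel T) : bool :=
  [&& (0 < #|T|)%N,
      [forall u, forall v, connect e u v]
    & ~~ [exists n : 'I_#|T|.+1, exists c : n.-tuple T,
           [&& (2 < n)%N, uniq c & path.cycle e c]]].

(** * k-coding trees *)

Section CodingTrees.

Variables (k : nat) (B W : finType).

(* A linear ordering of k+1 white vertices, indexed by positions modulo k+1. *)
Definition ordering : finType := {ffun 'I_k.+1 -> W}.

(* A cyclic ordering is a class of linear orderings under rotation. *)
Definition rotations (f : ordering) : {set ordering} :=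
  [set [ffun a => f (a + i)] | i : 'I_k.+1].

(* Black vertices B, white vertices W: the set of edges, and a cyclic ordering
   at each black vertex. *)
Definition ctree : finType :=
  ({set B * W} * {ffun B -> {set ordering}})%type.

Definition edges (t : ctree) : {set B * W} := t.1.
Definition cyc (t : ctree) (b : B) : {set ordering} := t.2 b.

Definition adj (t : ctree) : rel (B + W) := fun u v =>
  match u, v with
  | inl b, inr w => (b, w) \in edges t
  | inr w, inl b => (b, w) \in edges t
  | _, _ => false
  end.

Definition nbrs (t : ctree) (b : B) : {set W} := [set w | (b, w) \in edges t].

Definition is_coding_tree (t : ctree) : bool :=
  is_tree (adj t) &&
  [forall b, (#|nbrs t b| == k.+1) &&
     [exists f : ordering, [&& injectiveb f, [set f a | a in 'I_k.+1] == nbrs t b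
                             & cyc t b == rotations f]]].

Definition ct_transport (mu : {perm B}) (nu : {perm W}) (t : ctree) : ctree :=
  ([set (mu e.1, nu e.2) | e in edges t],
   [ffun b => [set [ffun a => nu ((f : ordering) a)]
                 | f in cyc t ((mu^-1)%g b)]]).

(* In a tree seen from a base vertex v0, [toward t v0 v u] says that u is the
   neighbor of v toward v0: v0 can be reached from u avoiding v. There is no
   such u for v = v0. *)
Definition toward (t : ctree) (v0 v u : B + W) : bool :=
  adj t v u &&
  connect (fun a b => [&& adj t a b, a != v & b != v]) u v0.

Section Action.

(* For a tree rooted at a white vertex r, the base vertex v0 is r. For a tree
   rooted at an edge (x, w), v0 is x, the subtrees W_1, ..., W_{k+1} being
   rooted at the neighbors of x. In both cases w0 is the white root; it is
   used below as the vertex in position k+1 at the only black vertex that has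
   no neighbor toward v0, namely x in the edge-rooted case. *)
Variables (t : ctree) (v0 : B + W) (w0 : W).

Definition last_nbr (b : B) : W :=
  odflt w0 [pick w | toward t v0 (inl b) (inr w)].

(* The linearization at b of the cyclic ordering, putting [last_nbr b] in
   position k+1. *)
Definition linear (b : B) : ordering :=
  odflt [ffun=> w0] [pick f in cyc t b | f 0 == last_nbr b].

Definition position (b : B) (w : W) : 'I_k.+1 :=
  odflt 0 [pick i | linear b i == w].

(* The permutation by which the recursive action of s acts at the black vertex
   b: it is s at the black vertices closest to v0, and if the path from b to v0
   starts with b, w, b', where w is in position i at b', it is rho_i of the
   permutation at b'. The first argument is a recursion bound, exceeding
   the number of black vertices strictly between b and v0. *)
Fixpoint twist (d : nat) (s : 'S_k.+1) (b : B) : 'S_k.+1 :=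
  if d is d'.+1 then
    if [pick u : W * B | toward t v0 (inl b) (inr u.1) &&
                         toward t v0 (inr u.1) (inl u.2)] is Some (w, b')
    then rho (position b' w) (twist d' s b')
    else s
  else s.

(* The subtree in position i at b moves to position [twist _ s b i]. *)
Definition twisted_linear (s : 'S_k.+1) (b : B) : ordering :=
  [ffun a => linear b (((twist #|B| s b)^-1)%g a)].

Definition ct_act (s : 'S_k.+1) : ctree :=
  (edges t, [ffun b => rotations (twisted_linear s b)]).

End Action.

End CodingTrees.

(** * The species of rooted k-coding trees *)

Definition CTY (k : nat) : gspecies 'S_k := {|
  gcarrier B W := (ctree k B W * W)%type;
  gstr B W := [set tr : ctree k B W * W | is_coding_tree tr.1];
  gtransport B W mu nu tr := (ct_transport mu nu tr.1, nu tr.2);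
  gact B W s tr := (ct_act tr.1 (inr tr.2) tr.2 (embed s), tr.2)
|}.

(* The root edge is (x, w); after the action of s its white vertex is the one
   moved to position k+1 at x. *)
Definition CTXY (k : nat) : gspecies 'S_k.+1 := {|
  gcarrier B W := (ctree k B W * (B * W))%type;
  gstr B W := [set te : ctree k B W * (B * W) |
                 is_coding_tree te.1 && (te.2 \in edges te.1)];
  gtransport B W mu nu te :=
    (ct_transport mu nu te.1, (mu te.2.1, nu te.2.2));
  gact B W s te :=
    let: (t, (x, w)) := te in
    (ct_act t (inl x) w s, (x, twisted_linear t (inl x) w s x 0))
|}.

(* Main.v *)
Require Import Defs.
From mathcomp Require Import all_boot all_order all_fingroup all_algebra.
From mathcomp Require Import boolp classical_sets fsbigop.
From mathcomp Require Import zify.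

Set Implicit Arguments.
Unset Strict Implicit.
Unset Printing Implicit Defensive.

Import GRing.Theory Num.Theory.

(** The generating function of either species counts unlabelled structures. By
    a twisted form of Burnside's lemma, 1/(m! n!) times the sum over mu and nu
    of the numbers of fixed points of s . F[mu, nu] is the number of
    isomorphism classes with m black and n white vertices that s maps to
    themselves ([burnside_twisted]); a coding tree with m black vertices has
    exactly k m + 1 white ones, so the coefficient of x^m is the number of
    fixed classes with m black vertices.

    An unlabelled tree rooted at a white vertex is a multiset of k-tuples of
    such trees. Cut off at depth d, and with multiplicities at most N, these
    trees form a finite type [utree k N d], defined by recursion on d, in
    which equal trees are equal terms; taking N and d at least m loses nothing
    with m black vertices. The bridge from labelled graphs is made in two
    steps. First, a rooted coding tree is the same as a forest on its black
    vertices together with an identification of the white vertices with the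
    positions at black vertices ([frame]): each black vertex b points to the
    pair of a black vertex and a position of the white vertex above b, and
    this function q carries the tree up to relabelling of white vertices
    ([frame_iso]). Secondly, [code] reads the unlabelled tree off q. It is
    invariant under relabelling ([code_embed]), equal codes come from
    isomorphic forests ([code_iso]), every unlabelled tree is a code
    ([realiseY], [realiseXY]), and the action on graphs becomes the recursive
    action on unlabelled trees ([code_twist]). This proves [ogf_CTY] and
    [ogf_CTXY].

    What remains is to count fixed multisets and fixed tuples. For a
    permutation pi of a weighted set, counting pairs of an invariant multiset
    of weight m and a marked copy of an element in it, weighted by that
    element, gives the recurrence that characterizes the exponential
    ([invmsets_rec], [fps_exp_unique]). A tuple fixed by s is determined on
    each cycle of s by its value at one position i, and going once around a
    cycle of length l acts on this value by rho_i(s^l) ([cycle_product]). As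
    s^l fixes i, the permutation rho_i(s^l) is s^l conjugated by a translation
    that carries i to position k+1, so on the remaining k positions it has the
    cycle type of s^l with one 1 removed ([ncycles_subrho]). Finally, the
    number of fixed trees depends only on the cycle type, because permutations
    of equal cycle type are conjugate ([ncycles_conj]). *)

(** * Trees as parent relations *)

Section RootedTrees.
Variables (T : finType) (e : rel T) (v0 : T).

(** The relation [toward] of a coding tree, for an arbitrary graph. *)
Definition nearer (v u : T) : bool :=
  e v u && connect (fun a b => [&& e a b, a != v & b != v]) u v0.

(** R v u reads: u is the parent of v. These properties characterize trees: a
    tree has them with R = [nearer] ([tree_rooted]), and conversely they force
    the graph to be a tree and R to be [nearer] ([rooted_tree]). *)
Record rooted_by (R : rel T) (h : T -> nat) : Prop := RootedBy {
  rooted_adj : forall u v, e u v = R u v || R v u;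
  rooted_height : forall v u, R v u -> h v = (h u).+1;
  rooted_fun : forall v u u', R v u -> R v u' -> u = u';
  rooted_total : forall v, v != v0 -> exists u, R v u;
  rooted_base : forall u, ~~ R v0 u;
  rooted_zero : h v0 = 0 }.

(** The tuple in [is_tree] is bounded by the number of vertices, which a
    duplicate-free cycle never exceeds. *)
Lemma no_cycle (c : seq T) : is_tree e -> uniq c -> path.cycle e c -> size c <= 2.
Proof.
case/and3P=> _ _ /existsPn H uc cc; rewrite leqNgt; apply/negP=> lt2.
have ltc : size c < #|T|.+1 by rewrite ltnS -(card_uniqP uc) max_card.
have := H (Ordinal ltc); move/existsPn/(_ (in_tuple c)).
by rewrite /= lt2 uc cc.
Qed.

Hypothesis e_irr : irreflexive e.

Lemma nearer_step v u p :
  path e v (u :: p) -> uniq (v :: u :: p) -> last u p = v0 -> nearer v u.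
Proof.
rewrite /= => /andP[evu pu] /andP[nv _] lp; rewrite /nearer evu /=.
apply/connectP; exists p => //.
elim: p u pu nv {evu lp} => //= w p IH u /andP[euw pw].
rewrite !inE !negb_or => /and3P[vu vw vp].
by rewrite euw eq_sym vu eq_sym vw /= IH // inE negb_or vw.
Qed.

Lemma path_nearer v p :
  path e v p -> uniq (v :: p) -> last v p = v0 -> path nearer v p.
Proof.
elim: p v => // u p IH v pv uv lv /=.
rewrite (nearer_step pv uv lv) /=; apply: IH => //; first by case/andP: pv.
by case/andP: uv.
Qed.

Lemma connect_avoid v u w :
  connect (fun a b => [&& e a b, a != v & b != v]) u w -> u != v ->
  exists p, [/\ path e u p, uniq (u :: p), v \notin u :: p & last u p = w].
Proof.
case/connectP=> p0 /shortenP[p pp up _] -> uv; exists p; split=> //.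
  by apply: sub_path pp => a b /and3P[].
rewrite inE negb_or eq_sym uv /=.
elim: p u pp {up uv} => //= a p IH u /andP[/and3P[_ _ av] pp].
by rewrite inE negb_or eq_sym av /=; apply: IH pp.
Qed.

Hypothesis e_sym : symmetric e.
Hypothesis tree_e : is_tree e.

Lemma nearer_base u : ~~ nearer v0 u.
Proof.
apply/negP=> /andP[evu] /connect_avoid; case.
  by apply/eqP=> uv; rewrite uv e_irr in evu.
by move=> p [_ _ + lp]; rewrite -{1}lp mem_last.
Qed.

Lemma base_path v :
  exists p, [/\ path e v p, uniq (v :: p) & last v p = v0].
Proof.
have /and3P[_ /forallP /(_ v) /forallP /(_ v0) + _] := tree_e.
by case/connectP=> p0 /shortenP[p pp up _] ->; exists p.
Qed.

(** Two neighbors of v nearer to the base are joined by a path avoiding v,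
    which closes up to a cycle through v. *)
Lemma nearer_fun v u u' : nearer v u -> nearer v u' -> u = u'.
Proof.
move=> /andP[evu cu] /andP[evu' cu']; apply/eqP; apply/negPn/negP=> uu'.
have uv : u != v by apply/eqP=> E; rewrite E e_irr in evu.
set r := fun a b => _ in cu cu'.
have sr : connect_sym r.
  by apply: sym_connect_sym => a b; rewrite /r e_sym [(a != v) && _]andbC.
have: connect r u u' by apply: connect_trans cu _; rewrite sr.
case/connect_avoid/(_ uv) => p [pp up vp lp].
have: size (v :: u :: p) <= 2.
  apply: no_cycle => //; first by rewrite cons_uniq vp.
  by rewrite (cycle_path v) /= lp e_sym evu' evu.
by case: p lp {pp up vp} => //= E; rewrite E eqxx in uu'.
Qed.

(** A simple path from u to the base either avoids v, so that u is nearer than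
    v, or reaches v; in that case v is its first vertex after u, since
    otherwise the edge closes a cycle. *)
Lemma nearer_adj u v : e u v -> nearer u v || nearer v u.
Proof.
move=> euv; have [p [pp up lp]] := base_path u.
have uv : u != v by apply/eqP=> E; rewrite E e_irr in euv.
have [vp|vp] := boolP (v \in p); last first.
  apply/orP; right; apply: (@nearer_step _ _ p) => //.
    by rewrite /= e_sym euv.
  by rewrite cons_uniq up inE negb_or eq_sym uv vp.
apply/orP; left.
case/path.splitP: vp pp up lp => [[|z p1] p2].
  by move=> pp up lp; apply: nearer_step pp up lp.
rewrite rcons_cons => pp up _; exfalso.
have: size (u :: z :: rcons p1 v) <= 2.
  apply: no_cycle => //.
    by move: up; rewrite -cat_cons cat_uniq => /andP[].
  rewrite (cycle_path u) /= last_rcons e_sym euv /=.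
  by move: pp; rewrite /= cat_path => /and3P[-> -> _].
by rewrite /= size_rcons.
Qed.

Lemma nearer_path_size v p p' :
  path nearer v p -> last v p = v0 -> path nearer v p' -> last v p' = v0 ->
  size p = size p'.
Proof.
elim: p v p' => [|u p IH] v [|u' p'] //=.
- by move=> _ -> /andP[]; rewrite (negPf (nearer_base _)).
- by move=> /andP[+ _] _ _ E; rewrite E (negPf (nearer_base _)).
move=> /andP[nu pu] lu /andP[nu' pu'] lu'; congr _.+1.
by move: pu' lu'; rewrite -(nearer_fun nu nu') => pu' lu'; apply: (IH _ _ pu lu pu' lu').
Qed.

(** The height is the length of the path of parents down to the base. *)
Theorem tree_rooted : exists h, rooted_by nearer h.
Proof.
have nP v : exists n, exists p,
    [/\ path nearer v p, last v p = v0 & size p = n].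
  have [p [pp up lp]] := base_path v.
  by exists (size p), p; split=> //; apply: path_nearer.
have [h hP] := choice nP; exists h; split.
- move=> u v; apply/idP/idP; first exact: nearer_adj.
  by case/orP=> /andP[//]; rewrite e_sym.
- move=> v u vu; have [p [pp lp <-]] := hP v; have [p' [pp' lp' <-]] := hP u.
  by apply: (@nearer_path_size v p (u :: p')) => //=; rewrite vu.
- by move=> v u u'; apply: nearer_fun.
- move=> v vv0; have [[|u p] [pp up lp]] := base_path v.
    by rewrite -lp eqxx in vv0.
  by exists u; apply: nearer_step pp up lp.
- exact: nearer_base.
have [[|u p] [/= vu _ <-]] := hP v0 => //.
by move: vu; rewrite (negPf (nearer_base _)).
Qed.

End RootedTrees.

(** The path of parents from a vertex only meets lower vertices. It connects
    the graph, and it shows that R implies [nearer]; the converse follows as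
    both relations are functional. *)
Theorem rooted_tree (T : finType) (e : rel T) (v0 : T) (R : rel T) h :
  rooted_by e v0 R h -> is_tree e /\ (nearer e v0 =2 R).
Proof.
move=> [adjE hE funR totR baseR _].
have irr : irreflexive e.
  by move=> v; rewrite adjE orbb; apply/negP=> /hE /n_Sn.
have sym : symmetric e by move=> u v; rewrite !adjE orbC.
have walk v : exists p, [/\ path e v p, last v p = v0 & all (fun u => h u < h v) p].
  have [n] := ubnP (h v); elim: n v => // n IH v /ltnSE lev.
  have [->|/totR[u vu]] := eqVneq v v0; first by exists [::].
  have hu := hE _ _ vu; have [|p [pp lp ap]] := IH u; first by rewrite -hu.
  exists (u :: p); rewrite /= adjE vu pp lp hu ltnSn; split=> //=.
  by apply: sub_all ap => w /leqW.
have con v : connect e v v0.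
  by have [p [pp <- _]] := walk v; apply/connectP; exists p.
have tree_e : is_tree e.
  apply/and3P; split.
  - by apply/card_gt0P; exists v0.
  - apply/forallP=> u; apply/forallP=> v; apply: connect_trans (con u) _.
    by rewrite (sym_connect_sym sym).
  apply/existsPn=> n; apply/existsPn=> c; apply/and3P=> -[n2 uc cc].
  have sc : 2 < size c by rewrite size_tuple.
  move: (val c) uc cc sc => {n c n2}c uc cc sc.
  have [x0 x0c] : exists x, x \in c by case: c sc {uc cc} => // x c; exists x; rewrite mem_head.
  (* Both neighbors of a highest vertex of a cycle are its parent. *)
  have [x xc le_m] := @arg_maxnP _ x0 (mem c) h x0c.
  have [i c' rc] := rot_to xc.
  move: uc cc sc; rewrite -(rot_uniq i) -(rot_cycle i) -(size_rot i) rc.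
  have {}le_m y : y \in x :: c' -> h y <= h x by rewrite -rc mem_rot; apply: le_m.
  case: c' rc le_m => [|y c'] // _ le_m; case/lastP: c' le_m => // c' z le_m.
  rewrite (cycle_path x) /= last_rcons => uc /and3P[ezx exy _] _.
  have up w : e x w -> w \in x :: y :: rcons c' z -> R x w.
    rewrite adjE => /orP[//|/hE E] /le_m; by rewrite E ltnn.
  have yz : y = z.
    apply: (funR x); first by apply: up => //; rewrite !inE eqxx orbT.
    by apply: up; [rewrite sym | rewrite !inE mem_rcons inE eqxx !orbT].
  by move: uc; rewrite yz /= mem_rcons inE eqxx andbF.
split=> // v u.
have RN w z : R w z -> nearer e v0 w z.
  move=> wz; rewrite /nearer adjE wz /=.
  have [p [pp lp ap]] := walk z; apply/connectP; exists p => //.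
  have hw := hE _ _ wz.
  have : h z < h w by rewrite hw.
  have {}ap : all (fun y => h y < h w) p.
    by apply: sub_all ap => y hy; rewrite hw leqW.
  have ne y : h y < h w -> y != w by apply: contraTneq => ->; rewrite ltnn.
  elim: p z pp ap {wz hw lp} => //= y p IH z /andP[ezy py] /andP[hy hp] hz.
  by rewrite ezy !ne //= IH.
apply/idP/idP; last exact: RN.
move=> N; have [vE|/totR[w vw]] := eqVneq v v0.
  by move: N; rewrite vE (negPf (nearer_base v0 irr u)).
by rewrite (nearer_fun irr sym tree_e N (RN _ _ vw)).
Qed.

(** * The exponential of a power series *)

Section PowerSeries.
Local Open Scope ring_scope.

Lemma fps_sumE (I : choiceType) (A : set I) (r : seq I) (f : I -> fps) m :
  uniq r -> (forall i, i \in r -> A i) ->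
  (forall i, A i -> i \notin r -> f i m = 0) ->
  fps_sum A f m = \sum_(i <- r) f i m.
Proof.
move=> ur rA f0; rewrite fsbig_seq //; apply/esym/fsbig_widen.
  by move=> i /rA.
by move=> i /= [Ai /negP ri]; apply: f0.
Qed.

Definition fps_trunc m (f : fps) : {poly rat} := \poly_(i < m.+1) f i.

Lemma fps_trunc_coef m f i : (i <= m)%N -> (fps_trunc m f)`_i = f i.
Proof. by move=> im; rewrite coef_poly ltnS im. Qed.

(** Identities between low coefficients are transferred to polynomials, where
    the ring operations and the derivative are available. *)
Lemma fps_mul_coef m f g (p q : {poly rat}) :
  (forall i, (i <= m)%N -> p`_i = f i) -> (forall i, (i <= m)%N -> q`_i = g i) ->
  forall i, (i <= m)%N -> (p * q)`_i = fps_mul f g i.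
Proof.
move=> fp gq i im; rewrite coefM; apply: eq_bigr => j _.
have ji : (j <= i)%N by rewrite -ltnS.
by rewrite fp ?gq // (leq_trans _ im) // leq_subr.
Qed.

Lemma fps_prod_coef m (I : eqType) (r : seq I) (f : I -> fps) (p : I -> {poly rat}) :
  (forall x i, x \in r -> (i <= m)%N -> (p x)`_i = f x i) ->
  forall i, (i <= m)%N ->
    (\prod_(x <- r) p x)`_i = (\big[fps_mul/fps_one]_(x <- r) f x) i.
Proof.
elim: r => [|x r IH] fp i im; first by rewrite !big_nil coef1.
rewrite !big_cons; apply: (fps_mul_coef (m := m)) => // j jm.
  by apply: fp; rewrite ?mem_head.
by apply: IH => // y l yr; apply: fp; rewrite inE yr orbT.
Qed.

Lemma fps_pow_coef m f j i : (i <= m)%N ->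
  (fps_trunc m f ^+ j)`_i = iter j (fps_mul f) fps_one i.
Proof.
elim: j i => [|j IH] i im; first by rewrite expr0 coef1.
by rewrite exprS /=; apply: (fps_mul_coef (m := m)) => // a; apply: fps_trunc_coef.
Qed.

Lemma coef_exp_small (p : {poly rat}) j i : p`_0 = 0 -> (i < j)%N -> (p ^+ j)`_i = 0.
Proof.
move=> p0; elim: j i => // j IH i ij; rewrite exprS coefM big1 // => -[[|a] /= ai] _.
  by rewrite p0 mul0r.
rewrite IH ?mulr0 //; move: ij; rewrite ltnS => ij.
by case: i ij ai => // i ij _; rewrite subSS (leq_ltn_trans (leq_subr _ _)).
Qed.

Lemma fps_exp_coef m f n i : f 0%N = 0 -> (i <= m)%N -> (i < n)%N ->
  fps_exp f i = (\sum_(j < n) j`!%:R^-1 *: fps_trunc m f ^+ j)`_i.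
Proof.
move=> f0 im in_; rewrite /fps_exp (@fps_sumE _ _ (iota 0 n)) ?iota_uniq //.
  rewrite coef_sum -{1}[n]subn0 -/(index_iota 0 n) big_mkord; apply: eq_bigr => j _.
  by rewrite coefZ fps_pow_coef.
move=> j _; rewrite mem_iota add0n /= -leqNgt => nj.
rewrite /fps_scale -(fps_pow_coef _ _ im) coef_exp_small ?mulr0 //.
  by rewrite fps_trunc_coef.
exact: leq_trans in_ nj.
Qed.

Lemma fps_exp0 f : f 0%N = 0 -> fps_exp f 0%N = 1.
Proof.
move=> f0; rewrite (@fps_exp_coef 0 _ 1) // big_ord1 expr0 coefZ coef1 fact0.
by rewrite invr1 mulr1.
Qed.

(** This is the equation E' = f' E, read off at the coefficient of x^(m-1). *)
Lemma fps_exp_rec f m : f 0%N = 0 ->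
  m%:R * fps_exp f m = \sum_(1 <= i < m.+1) i%:R * f i * fps_exp f (m - i)%N.
Proof.
move=> f0; case: m => [|m]; first by rewrite mul0r big_geq.
set p := fps_trunc m.+1 f.
set E := fun n => \sum_(j < n) j`!%:R^-1 *: p ^+ j.
have dE n : (E n.+1)^`() = p^`() * E n.
  rewrite /E big_ord_recl /= expr0 derivD derivZ derivC scaler0 add0r.
  rewrite raddf_sum mulr_sumr; apply: eq_bigr => j _.
  rewrite /= derivZ deriv_exp.
  have -> : bump 0 j = j.+1 by [].
  rewrite -scaler_nat scalerA -scalerAr; congr (_ *: _).
  by rewrite factS natrM invfM mulrAC mulVf ?mul1r ?pnatr_eq0.
(* Powers of f with exponent above m + 1 do not reach the coefficients used. *)
rewrite (@fps_exp_coef m.+1 _ m.+3) //.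
have /(congr1 (fun q : {poly rat} => q`_m)) := dE m.+2.
rewrite coef_deriv mulr_natl => H; rewrite [LHS]H coefM big_add1 big_mkord.
apply: eq_bigr => i _; rewrite coef_deriv fps_trunc_coef //.
congr (_ * _); first by rewrite mulr_natl.
rewrite subSS; apply/esym/fps_exp_coef => //.
  by apply: leq_trans (leq_subr _ _) _.
by rewrite ltnS; apply: leq_trans (leq_subr _ _) _.
Qed.

Lemma fps_exp_unique f E : f 0%N = 0 -> E 0%N = 1 ->
  (forall m, m%:R * E m = \sum_(1 <= i < m.+1) i%:R * f i * E (m - i)%N) ->
  E =1 fps_exp f.
Proof.
move=> f0 E0 Er m; have [n] := ubnP m; elim: n m => // n IH [|m] mn.
  by rewrite E0 fps_exp0.
have m0 : m.+1%:R != 0 :> rat by rewrite pnatr_eq0.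
apply: (mulfI m0); rewrite Er fps_exp_rec //.
apply: eq_big_nat => i /andP[i1 im]; rewrite IH //.
by rewrite ltnS in mn; apply: leq_trans mn; rewrite ltn_subrL i1.
Qed.

End PowerSeries.

(** * Multisets invariant under a permutation *)

Section Multisets.
Variables (A : finType) (w : A -> nat) (pi : {perm A}) (N : nat).
Hypothesis w_gt0 : forall a, 0 < w a.
Hypothesis w_pi : forall a, w (pi a) = w a.

Definition mweight (M : {ffun A -> 'I_N.+1}) : nat := \sum_a M a * w a.

Definition invmsets (m : nat) : {set {ffun A -> 'I_N.+1}} :=
  [set M | (mweight M == m) && [forall a, M (pi a) == M a]].

Lemma porbit_fix n a : ((pi ^+ n)%g a == a) = (#|porbit pi a| %| n).
Proof.
set l := #|porbit pi a|.
have itl q : (pi ^+ (q * l))%g a = a.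
  elim: q => [|q IH]; first by rewrite mul0n expg0 perm1.
  by rewrite mulSn expgD permM (permX _ _ l) iter_porbit.
rewrite {1}(divn_eq n l) expgD permM itl permX.
have ltl : n %% l < l by rewrite ltn_mod lt0n card_porbit_neq0.
rewrite /dvdn; apply/eqP/eqP => [E|->] //.
have := uniq_traject_porbit pi a; rewrite -/l => ut.
apply/eqP; rewrite -(nth_uniq a _ _ ut) ?size_traject //; last first.
  exact: leq_ltn_trans ltl.
by rewrite !nth_traject // ?E //; apply: leq_ltn_trans ltl.
Qed.

Lemma w_porbit a b : b \in porbit pi a -> w b = w a.
Proof.
case/porbitP=> n ->; rewrite permX.
by elim: n => //= n IH; rewrite w_pi.
Qed.

Lemma inv_porbit m (M : {ffun A -> 'I_N.+1}) a b : M \in invmsets m -> b \in porbit pi a -> M b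
    = M a.
Proof.
rewrite inE => /andP[_ /forallP Mpi] /porbitP[n ->]; rewrite permX.
by elim: n => //= n IH; rewrite (eqP (Mpi _)).
Qed.

Lemma mweight_ge (M : {ffun A -> 'I_N.+1}) a : M a <= mweight M.
Proof.
rewrite /mweight (bigD1 a) //=; apply: leq_trans (leq_addr _ _).
by rewrite leq_pmulr.
Qed.

Lemma porbit_weight a j :
  \sum_b (j * (b \in porbit pi a)) * w b = j * #|porbit pi a| * w a.
Proof.
rewrite (bigID (mem (porbit pi a))) /= [X in _ + X]big1 ?addn0; last first.
  by move=> b /negPf ->; rewrite muln0.
rewrite (eq_bigr (fun=> j * w a)); last by move=> b ba; rewrite ba muln1 (w_porbit ba).
by rewrite sum_nat_const; lia.
Qed.

(** Removing j copies of every element of the orbit of a is a bijection onto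
    the invariant multisets of the remaining weight. *)
Lemma invmsets_shift m a j : m <= N ->
  #|[set M : {ffun A -> 'I_N.+1} in invmsets m | j <= M a]| =
  if j * #|porbit pi a| * w a <= m
  then #|invmsets (m - j * #|porbit pi a| * w a)| else 0.
Proof.
move=> mN; set c := j * _ * _.
have le_c (M : {ffun A -> 'I_N.+1}) : M \in invmsets m -> j <= M a -> c <= m.
  move=> MS jM; move: (MS); rewrite inE => /andP[/eqP <- _].
  rewrite /c -porbit_weight; apply: leq_sum => b _; rewrite leq_mul2r.
  have [ba|] := boolP (b \in _); last by rewrite muln0 orbT.
  by rewrite (inv_porbit MS ba) muln1 jM orbT.
case: leqP => [cm|mc]; last first.
  apply/eqP; rewrite cards_eq0; apply/eqP/setP=> M; rewrite !inE.
  apply/negP=> /andP[MS jM].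
  have /le_c /(_ jM) : M \in invmsets m by rewrite inE.
  by rewrite leqNgt mc.
pose add (M : {ffun A -> 'I_N.+1}) : {ffun A -> 'I_N.+1} :=
  [ffun b => inord (M b + j * (b \in porbit pi a))].
have addE M b : M \in invmsets (m - c) ->
    add M b = M b + j * (b \in porbit pi a) :> nat.
  rewrite inE => /andP[/eqP Mw _]; rewrite ffunE inordK // ltnS.
  apply: leq_trans mN; rewrite -(subnK cm) -Mw leq_add ?mweight_ge //.
  rewrite /c; have [_|_] := boolP (b \in _); last by rewrite muln0.
  by rewrite muln1 -mulnA leq_pmulr // muln_gt0 w_gt0 lt0n card_porbit_neq0.
rewrite -[RHS](@card_in_imset _ _ add); last first.
  move=> M M' MS MS' E; apply/ffunP=> b; apply: val_inj => /=.
  have := congr1 (fun M : {ffun A -> 'I_N.+1} => M b : nat) E.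
  by rewrite !addE // => /addIn.
apply: eq_card => M; apply/setIdP/imsetP => [[MS jM]|[M' MS' ->]]; last first.
  split; last by rewrite addE // porbit_id muln1 leq_addl.
  move: (MS'); rewrite !inE => /andP[/eqP Mw /forallP Mpi]; apply/andP; split.
    rewrite /mweight (eq_bigr (fun b => M' b * w b + j * (b \in porbit pi a) * w b)).
      by rewrite big_split /= porbit_weight -/(mweight M') Mw subnK.
    by move=> b _; rewrite addE // mulnDl.
  apply/forallP=> b; rewrite -val_eqE /= !addE // (eqP (Mpi b)).
  by rewrite -!eq_porbit_mem (porbit_perm pi 1 b).
have jMb b : b \in porbit pi a -> j <= M b by move=> ba; rewrite (inv_porbit MS ba).
pose M' : {ffun A -> 'I_N.+1} := [ffun b => inord (M b - j * (b \in porbit pi a))].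
have M'E b : M' b = M b - j * (b \in porbit pi a) :> nat.
  by rewrite ffunE inordK // ltnS (leq_trans (leq_subr _ _)) // -ltnS.
have M'D b : M b = M' b + j * (b \in porbit pi a) :> nat.
  rewrite M'E subnK //; have [ba|_] := boolP (b \in _); last by rewrite muln0.
  by rewrite muln1 jMb.
have M'S : M' \in invmsets (m - c).
  move: (MS); rewrite !inE => /andP[/eqP <- /forallP Mpi]; apply/andP; split.
    rewrite -(eqn_add2r c) subnK ?(le_c _ MS) //; last first.
      by move: (MS); rewrite inE => /andP[/eqP -> _].
    rewrite /c -porbit_weight -big_split /=; apply/eqP/eq_bigr=> b _.
    by rewrite -mulnDl -M'D.
  apply/forallP=> b; rewrite -val_eqE /= !M'E (eqP (Mpi b)).
  by rewrite -!eq_porbit_mem (porbit_perm pi 1 b).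
by exists M' => //; apply/ffunP=> b; apply/val_inj; rewrite /= addE.
Qed.

(** Reindexing by n = j l. *)
Lemma sum_multiples (F : nat -> nat) m l (v : nat) : 0 < l -> 0 < v ->
  \sum_(1 <= j < m.+1 | j * l * v <= m) F (j * l) =
  \sum_(1 <= n < m.+1 | (l %| n) && (n * v <= m)) F n.
Proof.
move=> l0 v0; rewrite -[LHS]big_filter -[RHS]big_filter.
rewrite -(big_map (fun j => j * l) xpredT F); apply: perm_big.
apply: uniq_perm.
- rewrite map_inj_uniq ?filter_uniq ?iota_uniq // => x y /eqP.
  by rewrite eqn_pmul2r // => /eqP.
- by rewrite filter_uniq ?iota_uniq.
move=> n; rewrite mem_filter mem_index_iota; apply/mapP/idP.
  case=> j; rewrite mem_filter mem_index_iota => /and3P[jm j1 _] ->.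
  by rewrite dvdn_mull // jm muln_gt0 j1 l0 /= ltnS (leq_trans _ jm) // leq_pmulr.
case/and3P=> /andP[/dvdnP[j ->] jm] j1 nm; exists j => //.
rewrite mem_filter jm mem_index_iota /=; move: j1 nm.
rewrite muln_gt0 => /andP[-> _] /=; apply: leq_ltn_trans; exact: leq_pmulr.
Qed.

(** Both sides count the invariant multisets M of weight m with a marked copy
    of an element a, weighted by the weight of a. If the marked copy is the
    j-th one, removing j copies of the orbit of a, of length l, leaves weight
    m - n w(a) with n = j l, and these n are the exponents with pi^n a = a. *)
Theorem invmsets_rec m : m <= N ->
  m * #|invmsets m| = \sum_(1 <= i < m.+1) #|invmsets (m - i)| *
    \sum_(1 <= n < m.+1) \sum_(a | ((pi ^+ n)%g a == a) && (n * w a == i)) w a.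
Proof.
move=> mN.
have -> : m * #|invmsets m| = \sum_a w a * \sum_(M in invmsets m) M a.
  rewrite mulnC -sum_nat_const (eq_bigr (fun M : {ffun A -> 'I_N.+1} => mweight M)).
    rewrite exchange_big; apply: eq_bigr => a _ /=.
    by rewrite big_distrr; apply: eq_bigr => M _ /=; rewrite mulnC.
  by move=> M; rewrite inE => /andP[/eqP].
have cnt a : \sum_(M in invmsets m) M a =
    \sum_(1 <= n < m.+1 | (#|porbit pi a| %| n) && (n * w a <= m))
       #|invmsets (m - n * w a)|.
  rewrite -(@sum_multiples (fun n => #|invmsets (m - n * w a)|)) ?lt0n ?card_porbit_neq0 //;
      last first.
    by rewrite -lt0n.
  rewrite [RHS]big_mkcond /=.
  under [RHS]eq_bigr do rewrite -invmsets_shift //.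
  rewrite (eq_bigr (fun M : {ffun A -> 'I_N.+1} => \sum_(1 <= j < m.+1) (j <= M a))).
    rewrite exchange_big /=; apply: eq_bigr => j _; rewrite -sum1_card.
    rewrite [RHS]big_mkcond /= big_mkcond; apply: eq_bigr => M _.
    by rewrite [in RHS]finset.in_set; case: (M \in _); case: (j <= _).
  move=> M; rewrite inE => /andP[/eqP Mw _].
  have Mm : M a <= m by rewrite -Mw mweight_ge.
  have E1 : \sum_(1 <= j < (M a).+1) (j <= M a) = M a.
    under eq_big_nat => j /andP[_ jM] do rewrite -ltnS jM.
    by rewrite sum_nat_const_nat subn1 muln1.
  rewrite -[LHS]E1 [RHS](@big_cat_nat _ _ _ (M a).+1) //= -[LHS]addn0.
  congr (_ + _); rewrite big_nat_cond big1 // => j /andP[/andP[lt _] _].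
  by rewrite leqNgt lt.
under eq_bigr do rewrite cnt big_distrr /=.
under [RHS]eq_bigr do rewrite big_distrr /=.
rewrite [RHS]exchange_big /=.
under [RHS]eq_bigr => n _.
  under eq_bigr do rewrite big_distrr /= big_mkcondr /=.
  rewrite exchange_big /=.
  under eq_bigr => a _.
    rewrite -big_mkcond /=.
    rewrite (eq_bigl (fun i => i == n * w a)); last by move=> i; rewrite eq_sym.
    rewrite big_nat1_eq.
  over.
over.
under eq_bigr do rewrite big_mkcond /=.
rewrite exchange_big /=; apply: eq_big_nat => n /andP[n1 _].
rewrite [RHS]big_mkcond /=; apply: eq_bigr => a _.
rewrite porbit_fix; case: (_ %| n) => //=.
by rewrite muln_gt0 n1 w_gt0 ltnS [in LHS](mulnC (w a)).
Qed.

End Multisets.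

(** * Cycles and fixed tuples *)

Section CycleRepresentatives.
Variables (I : finType) (pi : {perm I}) (rep : {set I} -> I).
Hypothesis rep_in : forall C, C \in porbits pi -> rep C \in C.

Lemma porbit_in_porbits i : porbit pi i \in porbits pi. Proof. exact: imset_f. Qed.

Lemma porbit_rep i : porbit pi i = porbit pi (rep (porbit pi i)).
Proof.
by apply/eqP; rewrite eq_porbit_mem porbit_sym; apply/rep_in/imset_f.
Qed.

Definition cycle_dist (i : I) : nat :=
  index i (traject pi (rep (porbit pi i)) #|porbit pi i|).

Lemma dist_lt i : (cycle_dist i < #|porbit pi i|)%N.
Proof.
rewrite /cycle_dist -{2}(size_traject pi (rep (porbit pi i)) #|_|) index_mem.
by rewrite {2}porbit_rep -porbit_traject -porbit_rep porbit_id.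
Qed.

Lemma dist_perm i : (pi ^+ cycle_dist i)%g (rep (porbit pi i)) = i.
Proof.
rewrite permX -(nth_traject pi (dist_lt i)) nth_index //.
by rewrite {2}porbit_rep -porbit_traject -porbit_rep porbit_id.
Qed.

Lemma rep_porbit C : C \in porbits pi -> porbit pi (rep C) = C.
Proof. by case/imsetP=> i _ ->; rewrite -porbit_rep. Qed.

Lemma dist_iter C l : C \in porbits pi -> (l < #|C|)%N ->
  cycle_dist ((pi ^+ l)%g (rep C)) = l.
Proof.
move=> CP lC; rewrite /cycle_dist porbit_perm rep_porbit // permX.
rewrite -(nth_traject pi lC) index_uniq ?size_traject //.
by rewrite -{2}(rep_porbit CP) uniq_traject_porbit.
Qed.

Lemma dist_rep C : C \in porbits pi -> cycle_dist (rep C) = 0.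
Proof.
move=> CP; have := @dist_iter C 0 CP; rewrite expg0 perm1 => -> //.
by case/imsetP: CP => i _ ->; rewrite lt0n card_porbit_neq0.
Qed.

Lemma rep_cycle C : C \in porbits pi -> (pi ^+ #|C|)%g (rep C) = rep C.
Proof. by move=> CP; rewrite permX -{1}(rep_porbit CP) iter_porbit. Qed.

Lemma dist_step i :
  cycle_dist (pi i) = if (cycle_dist i).+1 == #|porbit pi i| then 0 else (cycle_dist i).+1.
Proof.
set C := porbit pi i; have CP : C \in porbits pi := porbit_in_porbits i.
have Ei : (pi ^+ cycle_dist i)%g (rep C) = i by exact: dist_perm.
have := dist_lt i; rewrite -/C leq_eqVlt; case: eqP => /= [lC _|_ lC].
  by rewrite -{1}Ei -permM -expgSr lC rep_cycle // dist_rep.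
by rewrite -(dist_iter CP lC) expgSr permM Ei.
Qed.

End CycleRepresentatives.

Section CycleProduct.
Local Open Scope ring_scope.
Variables (I U : finType) (pi : {perm I}) (tau : I -> U -> U) (sz : U -> nat).
Hypothesis sz_tau : forall i u, sz (tau i u) = sz u.
Variables (rep : {set I} -> I) (u0 : U).
Hypothesis rep_in : forall C, C \in porbits pi -> rep C \in C.

Fixpoint around (i : I) (l : nat) (u : U) : U :=
  if l is l'.+1 then tau ((pi ^+ l')%g i) (around i l' u) else u.

Definition is_fixed_tuple (a : {ffun I -> U}) : bool :=
  [forall i, a (pi i) == tau i (a i)].

(** A fixed tuple is determined by its values at the representatives of the
    cycles. *)
Lemma is_fixed_tupleP a i l : is_fixed_tuple a -> a ((pi ^+ l)%g i) = around i l (a i).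
Proof.
move/forallP=> fa; elim: l => [|l IH]; first by rewrite expg0 perm1.
by rewrite expgSr permM (eqP (fa _)) IH.
Qed.

Lemma sz_around i l u : sz (around i l u) = sz u.
Proof. by elim: l => //= l IH; rewrite sz_tau. Qed.

Let spread (f : {ffun {set I} -> U}) : {ffun I -> U} :=
  [ffun i => around (rep (porbit pi i)) (cycle_dist pi rep i) (f (porbit pi i))].

Let gather (a : {ffun I -> U}) : {ffun {set I} -> U} :=
  [ffun C => if C \in porbits pi then a (rep C) else u0].

Lemma gatherK a : is_fixed_tuple a -> spread (gather a) = a.
Proof.
move=> fa; apply/ffunP=> i; rewrite !ffunE porbit_in_porbits -is_fixed_tupleP //.
by rewrite dist_perm.
Qed.

Lemma spread_rep f C : C \in porbits pi -> spread f (rep C) = f C.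
Proof. by move=> CP; rewrite ffunE rep_porbit // dist_rep. Qed.

Lemma spread_fixed f :
  is_fixed_tuple (spread f) =
  [forall (C | C \in porbits pi), around (rep C) #|C| (f C) == f C].
Proof.
apply/idP/forall_inP => [fa C CP|fC].
  by rewrite -{1}(spread_rep f CP) -is_fixed_tupleP // rep_cycle // spread_rep.
apply/forallP=> i; rewrite !ffunE (porbit_perm pi 1 i) dist_step //.
have Ei := dist_perm rep_in i; case: ifP => [/eqP lC|_]; last by rewrite /= Ei.
rewrite /= -{1}(eqP (fC _ (porbit_in_porbits pi i))) -lC /=.
by rewrite Ei.
Qed.

(** A fixed tuple amounts to a choice, for each cycle C, of a value at its
    representative that returns to itself after going once around C; all |C|
    entries on C then have the same size. *)
Theorem cycle_product (R : comNzRingType) (x : R) :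
  \sum_(a : {ffun I -> U} | is_fixed_tuple a) x ^+ (\sum_i sz (a i)) =
  \prod_(C in porbits pi)
     \sum_(u | around (rep C) #|C| u == u) x ^+ (#|C| * sz u)%N.
Proof.
rewrite (big_distr_big_dep u0) /=.
rewrite (reindex_onto spread gather) /=; last exact: gatherK.
apply: eq_big => [f|f /andP[_ _]].
  apply/andP/pfamilyP => [[]|[sf fQ]].
    rewrite spread_fixed => /forall_inP fC /eqP fE; split.
      apply/fintype.subsetP=> C; rewrite -fE inE ffunE; case: ifP => //.
      by rewrite eqxx.
    by move=> C CP; exact: fC.
  split.
    by rewrite spread_fixed; apply/forall_inP => C /fQ.
  apply/eqP/ffunP=> C; rewrite ffunE; case: ifPn => [/spread_rep->//|CP].
  apply/esym/eqP; apply: contraNT CP => fC.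
  by move/fintype.subsetP: sf; apply.
rewrite (partition_big (porbit pi) (mem (porbits pi))) /=; last by move=> i _;
    exact: porbit_in_porbits.
rewrite expr_sum; apply: eq_bigr => C CP.
congr (_ ^+ _).
rewrite (eq_bigl (mem C)) => [|i]; last first.
  by rewrite -{1}(rep_porbit rep_in CP) eq_porbit_mem rep_porbit.
rewrite (eq_bigr (fun=> sz (f C))) ?sum_nat_const // => i iC.
rewrite ffunE sz_around; congr (sz (f _)).
by apply/eqP; rewrite -{1}(rep_porbit rep_in CP) eq_porbit_mem rep_porbit.
Qed.
End CycleProduct.

(** * Cycle types and conjugacy *)

Section FiberMatching.
Variables (X Y : finType) (C : eqType) (A : {set X}) (B : {set Y}).
Variables (c : X -> C) (c' : Y -> C) (y0 : Y).
Hypothesis card_fibers :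
  forall a, #|[set x in A | c x == a]| = #|[set y in B | c' y == a]|.

(** When the colourings c and c' have fibres of equal size, the elements of A
    and B of a given colour are matched by their ranks in the enumerations of
    the fibres. *)
Definition fiber_match (x : X) : Y :=
  nth y0 (enum [set y in B | c' y == c x])
         (index x (enum [set x' in A | c x' == c x])).

Lemma fiber_matchP x : x \in A -> fiber_match x \in B /\ c' (fiber_match x) = c x.
Proof.
move=> xA; have : fiber_match x \in [set y in B | c' y == c x].
  rewrite -mem_enum mem_nth // -cardE -card_fibers cardE index_mem mem_enum.
  by rewrite inE xA eqxx.
by rewrite inE => /andP[-> /eqP].
Qed.

Lemma fiber_match_inj : {in A &, injective fiber_match}.
Proof.
move=> x x' xA x'A E.
have Ec : c x' = c x by rewrite -(fiber_matchP xA).2 E (fiber_matchP x'A).2.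
have xI y : y \in A -> c y = c x -> y \in enum [set z in A | c z == c x].
  by move=> yA cy; rewrite mem_enum inE yA cy eqxx.
move/eqP: E; rewrite /fiber_match Ec nth_uniq ?enum_uniq //.
- by move/eqP/(congr1 (nth x (enum [set z in A | c z == c x]))); rewrite !nth_index ?xI.
- by rewrite -cardE -card_fibers cardE index_mem xI.
- by rewrite -cardE -card_fibers cardE index_mem xI.
Qed.
End FiberMatching.

Section CycleType.

Definition ncycles (T : finType) (s : {perm T}) (n : nat) : nat :=
  #|[set C in porbits s | #|C| == n]|.

Lemma count_cycle_type k (s : 'S_k) n : count_mem n (cycle_type s) = ncycles s n.
Proof.
rewrite /cycle_type (seq.permP (permEl (perm_sort _ _))) count_map -size_filter.
rewrite /ncycles cardE /enum_mem -filter_predI; congr size.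
by apply: eq_filter => C; rewrite /= !inE andbC.
Qed.

Variable T : finType.
Implicit Types s g : {perm T}.

(** A conjugating permutation maps cycles to cycles. *)
Lemma conj_ncycles s s' g : (forall x, g (s x) = s' (g x)) ->
  ncycles s =1 ncycles s'.
Proof.
move=> gs n.
have gsn m x : g ((s ^+ m)%g x) = (s' ^+ m)%g (g x).
  by elim: m => [|m IH]; rewrite ?expg0 ?perm1 // !expgSr !permM gs IH.
have gp x : porbit s' (g x) = g @: porbit s x.
  apply/setP=> y; apply/porbitP/imsetP => [[m ->]|[_ /porbitP[m ->] ->]].
    by exists ((s ^+ m)%g x); rewrite ?gsn // mem_porbit.
  by exists m; rewrite gsn.
rewrite /ncycles -(card_imset _ (imset_inj (@perm_inj _ g))); apply: eq_card => C.
rewrite inE; apply/imsetP/andP=> [[D]|[/imsetP[x _ ->]]].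
  rewrite inE => /andP[/imsetP[x _ ->] xn] ->; rewrite -gp imset_f // gp.
  by rewrite card_imset //; exact: perm_inj.
rewrite -[x](permKV g) gp card_imset; last exact: perm_inj.
by move=> xn; exists (porbit s (g^-1%g x)); rewrite // inE imset_f.
Qed.

(** Cycles of equal length are matched, and the conjugating permutation sends
    the point at distance n from the representative of a cycle to the point at
    distance n from the representative of the matched cycle. *)
Lemma ncycles_conj s s' : ncycles s =1 ncycles s' ->
  exists g : {perm T}, forall x, g (s x) = s' (g x).
Proof.
move=> E; have [x0 _|T0] := pickP (mem T); last first.
  by exists 1%g => x; have := T0 x.
pose rep (C : {set T}) := odflt x0 [pick x in C].
have repP (t : {perm T}) C : C \in porbits t -> rep C \in C.
  case/imsetP=> x _ ->; rewrite /rep; case: pickP => //= H.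
  by have := H x; rewrite porbit_id.
pose f := fiber_match (porbits s) (porbits s')
            (fun C : {set T} => #|C|) (fun C : {set T} => #|C|) finset.set0.
have fP C : C \in porbits s -> f C \in porbits s' /\ #|f C| = #|C|.
  by apply: (fiber_matchP _ E).
have fI : {in porbits s &, injective f} by apply: (fiber_match_inj E).
pose g x := (s' ^+ cycle_dist s rep x)%g (rep (f (porbit s x))).
have gorb x : porbit s' (g x) = f (porbit s x).
  rewrite /g porbit_perm (rep_porbit (@repP s')) //.
  by case: (fP _ (porbit_in_porbits s x)).
have gdist x : cycle_dist s' rep (g x) = cycle_dist s rep x.
  have [f1 f2] := fP _ (porbit_in_porbits s x).
  by apply: (dist_iter (@repP s')) => //; rewrite f2; apply: (dist_lt (@repP s)).
have gI : injective g.
  move=> x y xy.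
  have pE : porbit s x = porbit s y.
    by apply: fI; rewrite ?porbit_in_porbits // -!gorb xy.
  by rewrite -(dist_perm (@repP s) x) -(dist_perm (@repP s) y) pE -!gdist xy.
exists (perm gI) => x; rewrite !permE /g (porbit_perm s 1 x) (dist_step (@repP s)).
have [f1 f2] := fP _ (porbit_in_porbits s x).
rewrite -permM -expgSr; case: eqP => // ->.
by rewrite -f2 (rep_cycle (@repP s')) // expg0 perm1.
Qed.

End CycleType.

(** * The maps rho_i as permutations of k letters *)

Section Rho.
Local Open Scope ring_scope.
Variable k : nat.
Implicit Types (s t : 'S_k) (u v : 'S_k.+1) (i : 'I_k.+1).

Lemma embed_lift s (j : 'I_k) : embed s (lift ord0 j) = lift ord0 (s j).
Proof. exact: lift_perm_lift. Qed.

Lemma embed0 s : embed s 0 = 0.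
Proof. exact: lift_perm_id. Qed.

Lemma embedM s t : embed (s * t)%g = (embed s * embed t)%g.
Proof. by rewrite /embed -(lift_permM _ ord0). Qed.

Lemma embed1 : embed (1 : 'S_k)%g = 1%g.
Proof. exact: lift_perm1. Qed.

Lemma embedX s n : embed (s ^+ n)%g = (embed s ^+ n)%g.
Proof. by elim: n => [|n IH]; rewrite ?embed1 // !expgS embedM IH. Qed.

Lemma embed_inj : injective (@embed k).
Proof.
move=> s t E; apply/permP=> j; apply: (@lift_inj _ ord0).
by rewrite -!embed_lift E.
Qed.

Definition unembed u : 'S_k := odflt 1%g [pick s | embed s == u].

Lemma unembedK u : u 0 = 0 -> embed (unembed u) = u.
Proof.
move=> u0; rewrite /unembed; case: pickP => /= [s /eqP->//|/=].
have nz (j : 'I_k) : u (lift ord0 j) != 0.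
  by rewrite -u0 (inj_eq perm_inj) eq_sym neq_lift.
pose f (j : 'I_k) := odflt j (unlift ord0 (u (lift ord0 j))).
have fE j : lift ord0 (f j) = u (lift ord0 j).
  rewrite /f; case: unliftP => [j' ->|E] //=.
  by have := nz j; rewrite E eqxx.
have fI : injective f.
  by move=> a b /(congr1 (lift ord0)); rewrite !fE => /perm_inj /lift_inj.
move/(_ (perm fI))/eqP; case; apply/permP=> i.
case: (unliftP ord0 i) => [j ->|->]; first by rewrite embed_lift permE fE.
by rewrite [LHS]embed0 u0.
Qed.

Lemma rhoE i u a : rho i u a = u (i + a) - u i.
Proof. by rewrite permE. Qed.

Lemma rho_0 i u : rho i u 0 = 0.
Proof. by rewrite rhoE addr0 subrr. Qed.

Lemma rho1 i : rho i 1%g = 1%g.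
Proof. by apply/permP=> a; rewrite rhoE !perm1 addrC addKr. Qed.

(** The cocycle identity behind the recursive action being an action. *)
Lemma rhoM i u v : rho i (u * v)%g = (rho i u * rho (u i) v)%g.
Proof.
by apply/permP=> a; rewrite permM !rhoE !permM [u i + _]addrC subrK.
Qed.

(** As [rho i u] fixes position k+1, it comes from a permutation of the first
    k positions. *)
Definition subrho i u : 'S_k := unembed (rho i u).

Lemma embed_subrho i u : embed (subrho i u) = rho i u.
Proof. by rewrite unembedK // rho_0. Qed.

Lemma subrho1 i : subrho i 1%g = 1%g.
Proof. by apply: embed_inj; rewrite embed_subrho rho1 embed1. Qed.

Lemma subrhoM i u v : subrho i (u * v)%g = (subrho i u * subrho (u i) v)%g.
Proof. by apply: embed_inj; rewrite embedM !embed_subrho rhoM. Qed.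

Lemma ncycles_embed s n : ncycles (embed s) n = ((n == 1) + ncycles s n)%N.
Proof.
have lI : injective (lift ord0 : 'I_k -> 'I_k.+1) := @lift_inj _ ord0.
have embX m j : (embed s ^+ m)%g (lift ord0 j) = lift ord0 ((s ^+ m)%g j).
  by rewrite -embedX embed_lift.
have p0 : porbit (embed s) 0 = [set 0].
  apply/setP=> y; rewrite inE; apply/porbitP/eqP=> [[m ->]|->].
    by rewrite -embedX embed0.
  by exists 0%N; rewrite expg0 perm1.
have pl j : porbit (embed s) (lift ord0 j) = lift ord0 @: porbit s j.
  apply/setP=> y; apply/porbitP/imsetP => [[m ->]|[_ /porbitP[m ->] ->]].
    by exists ((s ^+ m)%g j); rewrite ?embX // mem_porbit.
  by exists m; rewrite embX.
pose L := [set C in porbits s | #|C| == n].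
have -> : ncycles (embed s) n =
    #|[set C in [set [set 0 : 'I_k.+1]] | #|C| == n] :|: (fun C : {set 'I_k} => lift ord0 @: C)
        @: L|.
  apply: eq_card => C; rewrite !inE; apply/andP/orP=> [[/imsetP[i _ ->]]|].
    case: (unliftP ord0 i) => [j ->|->] ; last by left; rewrite p0 eqxx -p0.
    rewrite pl card_imset // => jn; right; apply/imsetP; exists (porbit s j) => //.
    by rewrite inE imset_f.
  case=> [/andP[/eqP-> ->]|/imsetP[D]].
    by split=> //; rewrite -p0 imset_f.
  rewrite inE => /andP[/imsetP[j _ ->] jn] ->; split; last by rewrite card_imset.
  by rewrite -pl imset_f.
rewrite cardsU [X in (_ - X)%N](_ : _ = 0%N) ?subn0; last first.
  apply/eqP; rewrite cards_eq0; apply/eqP/setP=> C; rewrite !inE.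
  apply/negP=> /andP[/andP[/eqP-> _] /imsetP[D _ /setP /(_ 0)]].
  rewrite inE eqxx => /esym/imsetP[j _ E].
  by have := neq_lift ord0 j; rewrite -E eqxx.
rewrite card_imset; last exact: imset_inj; congr (_ + _)%N.
rewrite eq_sym; case: eqP => [n1|n1].
  rewrite (_ : [set _ in _ | _] = [set [set 0]]) ?cards1 //.
  by apply/setP=> C; rewrite !inE; case: eqP => // ->; rewrite cards1 n1 eqxx.
apply/eqP; rewrite cards_eq0; apply/eqP/setP=> C; rewrite !inE.
by apply/negP=> /andP[/eqP ->]; rewrite cards1 => /eqP.
Qed.

(** When u fixes i, [rho i u] is conjugate to u by the translation a |-> a -
    i. *)
Lemma ncycles_subrho i u n : u i = i ->
  ncycles u n = ((n == 1) + ncycles (subrho i u) n)%N.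
Proof.
move=> ui; rewrite -ncycles_embed embed_subrho.
apply: (@conj_ncycles _ _ _ (perm (addIr (- i)))) => x.
by rewrite !permE /rho_fun ui [i + _]addrC subrK.
Qed.

End Rho.

(** * Unlabelled trees of bounded depth *)

Section Unlabelled.
Variables k N : nat.

(** A multiset of k-tuples of trees of smaller depth is a multiplicity
    function. The bound N on multiplicities keeps the type finite, and
    equality of terms is isomorphism. *)
Fixpoint utree (d : nat) : finType :=
  if d is d'.+1 then {ffun {ffun 'I_k -> utree d'} -> 'I_N.+1} else unit.

Notation below d := ({ffun {ffun 'I_k -> utree d} -> 'I_N.+1}).

Fixpoint usize (d : nat) : utree d -> nat :=
  if d is d'.+1 return utree d -> nat then
    fun u : below d' => \sum_a u a * (\sum_i usize (a i)).+1
  else fun=> 0.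

(** The multiset is moved by the action on k-tuples, so its multiplicity
    function is composed with the action of the inverse; see [uactE]. *)
Fixpoint uact (d : nat) (s : 'S_k) : utree d -> utree d :=
  if d is d'.+1 return utree d -> utree d then
    fun u : below d' => [ffun a : {ffun 'I_k -> utree d'} =>
      let t := (s^-1)%g in
      u [ffun j => uact (subrho (lift ord0 (t^-1 j)%g) (embed t)) (a (t^-1 j)%g)]]
  else id.

(** The action on the subtrees of a black vertex, in the form W'_(s(i)) =
    rho_i(s) W_i. The k subtrees below a black vertex that has a parent and
    the k+1 subtrees around a root edge are both covered, by the choice of the
    set of ports. *)
Definition tuple_act (d : nat) (I : finType) (ports : I -> 'I_k.+1) (pi : {perm I})
    (s : 'S_k.+1) (a : {ffun I -> utree d}) : {ffun I -> utree d} :=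
  [ffun j => uact (subrho (ports (pi^-1 j)%g) s) (a (pi^-1 j)%g)].

Definition black_act d s := @tuple_act d 'I_k (lift ord0) s (embed s).

Definition tuple_size d (I : finType) (a : {ffun I -> utree d}) : nat :=
  \sum_i usize (a i).

Lemma tuple_actE d (I : finType) (ports : I -> 'I_k.+1) (pi : {perm I}) (s : 'S_k.+1) (a :
    {ffun I -> utree d}) i :
  tuple_act ports pi s a (pi i) = uact (subrho (ports i) s) (a i).
Proof. by rewrite ffunE permK. Qed.

Lemma uactE d s (u : utree d.+1) a :
  (uact s u : below d) a = (u : below d) (black_act s^-1 a).
Proof. by rewrite ffunE. Qed.

Lemma usizeE d (u : utree d.+1) :
  usize u = \sum_a (u : below d) a * (tuple_size a).+1.
Proof. by []. Qed.

Lemma uact1 d (u : utree d) : uact 1%g u = u.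
Proof.
elim: d u => [[]//|d IH] u; apply/ffunP=> a; rewrite uactE; congr (u _).
apply/ffunP=> j; rewrite ffunE invgK perm1 invg1 embed1 subrho1.
exact: IH.
Qed.

(** Stated relative to the law for [uact] at the same depth, as the two laws
    are proved by a simultaneous induction on the depth. *)
Lemma tuple_actM_from d (I : finType) (ports : I -> 'I_k.+1) (pi pi' : {perm I}) (s s' :
    'S_k.+1) (a : {ffun I -> utree d}) :
  (forall s t u, @uact d (s * t)%g u = uact t (uact s u)) ->
  (forall i, s (ports i) = ports (pi i)) ->
  tuple_act ports (pi * pi')%g (s * s')%g a = tuple_act ports pi' s' (tuple_act ports pi s a).
Proof.
move=> uM sP; apply/ffunP=> j; have [i ->] : exists i, j = (pi * pi')%g i.
  by exists ((pi * pi')^-1%g j); rewrite permKV.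
by rewrite tuple_actE permM !tuple_actE subrhoM uM sP.
Qed.

Lemma uactM d s t (u : utree d) : uact (s * t)%g u = uact t (uact s u).
Proof.
elim: d s t u => [//|d IH] s t u; apply/ffunP=> a; rewrite !uactE; congr (u _).
by rewrite invMg /black_act embedM; apply: tuple_actM_from => // i; rewrite embed_lift.
Qed.

Lemma tuple_actM d (I : finType) (ports : I -> 'I_k.+1) (pi pi' : {perm I}) (s s' : 'S_k.+1) (a
    : {ffun I -> utree d}) :
  (forall i, s (ports i) = ports (pi i)) ->
  tuple_act ports (pi * pi')%g (s * s')%g a = tuple_act ports pi' s' (tuple_act ports pi s a).
Proof. by move=> sP; apply: tuple_actM_from => // ? ? ?; apply: uactM. Qed.

Lemma black_actM d s t (a : {ffun 'I_k -> utree d}) :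
  black_act (s * t)%g a = black_act t (black_act s a).
Proof. by rewrite /black_act embedM tuple_actM // => i; rewrite embed_lift. Qed.

Lemma black_act1 d (a : {ffun 'I_k -> utree d}) : black_act 1%g a = a.
Proof.
by apply/ffunP=> j; rewrite -{1}[j]perm1 tuple_actE embed1 subrho1 uact1.
Qed.

Lemma black_actK d s : cancel (@black_act d s) (black_act s^-1%g).
Proof. by move=> a; rewrite -black_actM mulgV black_act1. Qed.

Lemma black_actKV d s : cancel (@black_act d s^-1%g) (black_act s).
Proof. by move=> a; rewrite -black_actM mulVg black_act1. Qed.

Lemma uact_inj d s : injective (@uact d s).
Proof. by apply: (can_inj (g := uact s^-1%g)) => u; rewrite -uactM mulgV uact1. Qed.

Lemma tuple_act_fixed d (I : finType) (ports : I -> 'I_k.+1) (pi : {perm I}) (s : 'S_k.+1) (a :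
    {ffun I -> utree d}) :
  (tuple_act ports pi s a == a) =
  is_fixed_tuple pi (fun i => @uact d (subrho (ports i) s)) a.
Proof.
apply/eqP/forallP=> [E i|fa]; first by rewrite -{1}E tuple_actE.
apply/ffunP=> j; rewrite -[j](permKV pi) tuple_actE; apply/esym/eqP; exact: fa.
Qed.

Lemma tuple_size_act_from d (I : finType) (ports : I -> 'I_k.+1) (pi : {perm I}) (s : 'S_k.+1)
    (a : {ffun I -> utree d}) :
  (forall s u, @usize d (uact s u) = usize u) ->
  tuple_size (tuple_act ports pi s a) = tuple_size a.
Proof.
move=> us; rewrite /tuple_size [LHS](reindex_inj (@perm_inj _ pi)) /=.
by apply: eq_bigr => i _; rewrite tuple_actE us.
Qed.

Lemma usize_uact d s (u : utree d) : usize (uact s u) = usize u.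
Proof.
elim: d s u => // d IH s u; rewrite !usizeE.
rewrite [LHS](reindex_inj (can_inj (@black_actK d s))) /=.
by apply: eq_bigr => a _; rewrite uactE black_actK tuple_size_act_from.
Qed.

Lemma tuple_size_act d (I : finType) (ports : I -> 'I_k.+1) (pi : {perm I}) (s : 'S_k.+1) (a :
    {ffun I -> utree d}) :
  tuple_size (tuple_act ports pi s a) = tuple_size a.
Proof. by apply: tuple_size_act_from => *; apply: usize_uact. Qed.

Definition fixed_trees d s m : {set utree d} := [set u | (usize u == m) && (uact s u == u)].

(** Acting by g maps the trees fixed by s to those fixed by its conjugate. *)
Lemma fixed_trees_conj d (s s' : 'S_k) m : ncycles s =1 ncycles s' ->
  #|fixed_trees d s m| = #|fixed_trees d s' m|.
Proof.
suff le t t' : ncycles t =1 ncycles t' -> #|fixed_trees d t m| <= #|fixed_trees d t' m|.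
  by move=> E; apply/eqP; rewrite eqn_leq !le // => n; rewrite E.
move=> /ncycles_conj[g gE]; rewrite -(card_imset _ (@uact_inj d g)).
apply/subset_leq_card/fintype.subsetP=> _ /imsetP[u + ->].
rewrite !inE usize_uact => /andP[-> /eqP uf] /=.
rewrite -{2}uf -!uactM; apply/eqP; congr (uact _ u).
by apply/permP=> x; rewrite !permM.
Qed.

(** By the cocycle identity the maps rho along the cycle compose to the single
    map rho_i(s^l). *)
Lemma around_uact d (I : finType) (ports : I -> 'I_k.+1) (pi : {perm I}) (s : 'S_k.+1) i l (u :
    utree d) :
  (forall i, s (ports i) = ports (pi i)) ->
  around pi (fun i => @uact d (subrho (ports i) s)) i l u =
  uact (subrho (ports i) (s ^+ l)%g) u.
Proof.
move=> sP; have sPn n : (s ^+ n)%g (ports i) = ports ((pi ^+ n)%g i).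
  by elim: n => [|n IH]; rewrite ?expg0 ?perm1 // !expgSr !permM IH sP.
elim: l => [|l IH]; first by rewrite expg0 subrho1 uact1.
by rewrite /= IH -uactM expgSr subrhoM sPn.
Qed.

(** An instance of [invmsets_rec]: trees of depth d+1 fixed by s are the
    multisets of k-tuples that are invariant under the permutation of k-tuples
    given by s. *)
Theorem fixed_trees_rec d s m : m <= N ->
  m * #|fixed_trees d.+1 s m| = \sum_(1 <= i < m.+1) #|fixed_trees d.+1 s (m - i)| *
    \sum_(1 <= n < m.+1)
      \sum_(a : {ffun 'I_k -> utree d} |
              (black_act (s ^+ n)%g a == a) && (n * (tuple_size a).+1 == i)) (tuple_size a).+1.
Proof.
move=> mN; pose pi : {perm {ffun 'I_k -> utree d}} := perm (can_inj (@black_actK d s)).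
have piX n a : (pi ^+ n)%g a = black_act (s ^+ n)%g a.
  elim: n => [|n IH]; first by rewrite !expg0 perm1 black_act1.
  by rewrite !expgSr permM IH permE black_actM.
have uE j : fixed_trees d.+1 s j = invmsets (fun a => (tuple_size a).+1) pi N j.
  apply/setP=> u; rewrite !inE; congr (_ && _).
  apply/eqP/forallP=> [uf a|uf].
    by rewrite permE -{1}uf uactE black_actK.
  apply/ffunP=> a; rewrite uactE -{2}(black_actKV s a).
  by have := uf (black_act s^-1%g a); rewrite permE => /eqP->.
rewrite !uE (@invmsets_rec _ (fun a => (tuple_size a).+1) pi N) //; last first.
  by move=> a; rewrite permE tuple_size_act.
apply: eq_bigr => i _; rewrite uE; congr (_ * _).
by apply: eq_bigr => n _; apply: eq_bigl => a; rewrite piX.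
Qed.

End Unlabelled.

(** * Codes of labelled forests *)

Section Codes.
Variables k N : nat.
Notation utree := (utree k N).
Notation below d := ({ffun {ffun 'I_k -> utree d} -> 'I_N.+1}).

(** Where a black vertex hangs: in position i at the black vertex b for Some
    (b, i), at the root white vertex for None. A function B -> port B is a
    forest on B. *)
Definition port (B : Type) := option (B * 'I_k.+1).

Definition port_map B B' (f : B -> B') : port B -> port B' :=
  omap (fun p => (f p.1, p.2)).

(** This makes delta the depth in the forest given by q, and excludes infinite
    chains of parents. *)
Definition ranked (B : Type) (q : B -> port B) (delta : B -> nat) : Prop :=
  forall b, delta b = if q b is Some (b', _) then (delta b').+1 else 0.

(** The ports that name white vertices. For v = None the tree is rooted at a
    white vertex, and position k+1 (the residue 0) at b is the parent of b.
    For v = Some x it is rooted at x, all k+1 positions at x lead away from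
    the root, and no white vertex is named by None. *)
Definition valid (B : eqType) (v : option B) (p : port B) : bool :=
  if p is Some (b, i) then (i != 0%R) || (v == Some b) else v == None.

Definition rooted (B : eqType) (v : option B) (q : B -> port B) : Prop :=
  forall b, if v == Some b then q b = None else valid v (q b).

Section Code.
Variables (B : finType) (q : B -> port B).

(** The unlabelled tree below a port, cut off at depth d. The value of inord
    is the number of children itself as soon as #|B| <= N ([codeK]). *)
Fixpoint code (d : nat) : port B -> utree d :=
  if d is d'.+1 return port B -> utree d then
    fun p => [ffun a => inord #|[set b | (q b == p) &&
                ([ffun j => code d' (Some (b, lift ord0 j))] == a)]|]
  else fun=> tt.

Definition tuple_code (I : finType) (ports : I -> 'I_k.+1) d (b : B) : {ffun I -> utree d} :=
  [ffun i => code d (Some (b, ports i))].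

Definition black_code := @tuple_code 'I_k (lift ord0).

Lemma codeE d p a : (code d.+1 p : below d) a =
  inord #|[set b | (q b == p) && (black_code d b == a)]|.
Proof. by rewrite ffunE. Qed.

Hypothesis BN : #|B| <= N.

Lemma codeK d p a : (code d.+1 p : below d) a =
  #|[set b | (q b == p) && (black_code d b == a)]| :> nat.
Proof. by rewrite codeE inordK // ltnS (leq_trans (max_card _)). Qed.

Lemma usize_code d p :
  usize (code d.+1 p) = \sum_(b | q b == p) (tuple_size (black_code d b)).+1.
Proof.
rewrite usizeE (partition_big (black_code d) xpredT) //=; apply: eq_bigr => a _.
rewrite codeK -sum1_card big_distrl /=.
rewrite (eq_bigl (fun b => (q b == p) && (black_code d b == a))); last by move=> b; rewrite inE.
by apply: eq_bigr => b /andP[_ /eqP->]; rewrite mul1n.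
Qed.

End Code.

(** The code below a port sees only the descendants of the port. This serves
    for relabelling and for the grafting of forests. *)
Lemma code_embed (B B' : finType) (q : B -> port B) (q' : B' -> port B')
    (phi : B -> B') (p0 : port B') :
  injective phi ->
  let psi p := if p is Some (b, i) then Some (phi b, i) else p0 in
  (forall p b', q' b' = psi p <-> exists2 b, b' = phi b & q b = p) ->
  forall d p, code q' d (psi p) = code q d p.
Proof.
move=> phiI psi H; elim=> [//|d IH] p; apply/ffunP=> a; rewrite !codeE.
congr inord; rewrite -(card_imset _ phiI); apply: eq_card => b'.
have tE b : black_code q' d (phi b) = black_code q d b.
  by apply/ffunP=> j; rewrite !ffunE -IH.
rewrite inE; apply/andP/imsetP=> [[/eqP/H[b -> qb]]|[b]].
  by rewrite tE => ta; exists b; rewrite // inE qb eqxx.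
rewrite inE => /andP[/eqP qb ta] ->; rewrite tE; split=> //.
by apply/eqP/H; exists b.
Qed.

Section Twist.
Variables (B : finType) (q q' : B -> port B) (tw : B -> 'S_k.+1).
Hypothesis q'E : forall b,
  q' b = if q b is Some (b', i) then Some (b', tw b' i) else None.
Hypothesis twE : forall b b' i, q b = Some (b', i) -> tw b = rho i (tw b').

(** The twisted forest q' has the same black children as q at each port, moved
    to another position, and below each of them the twist is again of the same
    form, with s replaced by rho_j(s). *)
Lemma code_twist d p p' s :
  (forall b, (q' b == p') = (q b == p)) ->
  (forall b, q b = p -> tw b = embed s) ->
  code q' d p' = uact s (code q d p).
Proof.
elim: d p p' s => [//|d IH] p p' s pp' ts; apply/ffunP=> a.
rewrite uactE !codeE; congr inord; apply: eq_card => b; rewrite !inE pp'.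
case: eqP => //= qb; rewrite -[RHS](inj_eq (can_inj (@black_actK k N d s))) black_actKV.
congr (_ == _); apply/ffunP=> j.
rewrite -[j](permKV s) tuple_actE !ffunE -embed_lift -(ts _ qb).
apply: IH => [b''|b'' qb'']; last by rewrite embed_subrho (twE qb'').
rewrite q'E; case: (q b'') => [[b1 i1]|] //.
rewrite !/(Some _ == Some _) /= !xpair_eqE; case: eqP => //= ->.
by rewrite (inj_eq perm_inj).
Qed.

Lemma code_twist_port d b i :
  code q' d (Some (b, tw b i)) = uact (subrho i (tw b)) (code q d (Some (b, i))).
Proof.
apply: code_twist => [b''|b'' qb'']; last by rewrite embed_subrho (twE qb'').
rewrite q'E; case: (q b'') => [[b1 i1]|] //.
rewrite !/(Some _ == Some _) /= !xpair_eqE; case: eqP => //= ->.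
by rewrite (inj_eq perm_inj).
Qed.

Lemma tuple_code_twist d b :
  tuple_code q' id d b = tuple_act id (tw b) (tw b) (tuple_code q id d b).
Proof.
apply/ffunP=> j; rewrite -[j](permKV (tw b)) tuple_actE !ffunE.
exact: code_twist_port.
Qed.

End Twist.

Section Levels.
Variables (B : finType) (q : B -> port B) (delta : B -> nat).
Hypothesis BN : #|B| <= N.
Hypothesis q_ranked : ranked q delta.

Definition level e : {set B} := [set b | delta b == e].

Lemma sum_level n : (forall b, delta b < n) -> \sum_(j < n) #|level j| = #|B|.
Proof.
move=> dn; rewrite -sum1_card (partition_big (fun b => Ordinal (dn b)) xpredT) //=.
apply: eq_bigr => j _; rewrite -sum1_card; apply: eq_bigl => b.
by rewrite inE -val_eqE.
Qed.

(** Each black vertex of depth e+1 hangs in exactly one position at exactly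
    one vertex of depth e. *)
Lemma next_level (I : finType) (ports : I -> 'I_k.+1) d e :
  injective ports ->
  (forall b b' i, q b = Some (b', i) -> delta b' = e -> exists j, i = ports j) ->
  \sum_(b in level e) tuple_size (tuple_code q ports d.+1 b) =
  \sum_(b in level e.+1) (tuple_size (black_code q d b)).+1.
Proof.
move=> pI qp; rewrite [RHS]big_mkcond /=.
transitivity (\sum_(b in level e) \sum_i \sum_(c | q c == Some (b, ports i)) (tuple_size
    (black_code q d c)).+1).
  apply: eq_bigr => b _; apply: eq_bigr => i _.
  by rewrite ffunE usize_code.
rewrite pair_big_dep /= (exchange_big_dep xpredT) //=; apply: eq_bigr => c _.
rewrite inE q_ranked; case qc: (q c) => [[b i]|]; last by rewrite big_pred0 // => -[b i];
    rewrite andbF.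
rewrite eqSS; case: eqP => [be|be].
  have [j ij] := qp _ _ _ qc be.
  rewrite (big_pred1 (b, j)) // => -[b' i'] /=.
  rewrite inE andbT !/(Some _ == Some _) /= !xpair_eqE ij (inj_eq pI).
  rewrite eq_sym [j == _]eq_sym [(b == b')]eq_sym.
  by have [->|] := eqVneq b' b; rewrite ?andbF // be eqxx.
rewrite big_pred0 // => -[b' i'] /=.
rewrite inE andbT !/(Some _ == Some _) /= !xpair_eqE.
by apply/negP=> /andP[/eqP b'e /andP[/eqP b'b _]]; rewrite b'b in be.
Qed.

Lemma level_sizes d e :
  (forall b b' i, q b = Some (b', i) -> e <= delta b' -> i != 0%R) ->
  \sum_(b in level e) (tuple_size (black_code q d b)).+1 = \sum_(j < d.+1) #|level (e + j)|.
Proof.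
elim: d e => [|d IH] e qi.
  rewrite big_ord1 addn0 -sum1_card; apply: eq_bigr => b _.
  by rewrite /tuple_size big1 // => i _; rewrite ffunE.
under eq_bigr do rewrite -addn1.
rewrite big_split /= sum1_card next_level; last 2 first.
- exact: lift_inj.
- move=> b b' i qb be; have := qi _ _ _ qb; rewrite be => /(_ (leqnn _)) i0.
  by case: (unliftP ord0 i) i0 => [j ->|->] //; exists j.
rewrite IH; last by move=> b b' i qb /ltnW; apply: qi qb.
rewrite [RHS]big_ord_recl addn0 addnC; congr (_ + _).
by apply: eq_bigr => j _; rewrite addSnnS.
Qed.

(** A vertex of depth e has ancestors of all smaller depths. *)
Lemma rank_lt b : delta b < #|B|.
Proof.
suff H e : forall b, delta b = e -> e < #|[set c | delta c <= e]|.
  by apply: leq_trans (H _ _ erefl) (max_card _).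
elim: e => [|e IH] {}b be.
  by apply/card_gt0P; exists b; rewrite inE be.
have := q_ranked b; rewrite be; case qb: (q b) => [[b' i]|] // [/esym b'e].
apply: leq_ltn_trans (IH _ b'e) _; apply: proper_card; apply/fintype.properP; split.
  by apply/fintype.subsetP=> c; rewrite !inE => /leqW.
by exists b; rewrite !inE be // ltnn.
Qed.

(** Summing level by level, each black vertex is counted once. *)
Lemma usize_root d : rooted None q -> (forall b, delta b < d) ->
  usize (code q d None) = #|B|.
Proof.
move=> qr; case: d => [|d] dd.
  by apply/esym/eqP; rewrite -leqn0 leqNgt; apply/negP=> /card_gt0P[b _]; have := dd b.
rewrite usize_code // -(sum_level dd) -[RHS](@level_sizes d 0).
  apply: eq_bigl => b; rewrite inE q_ranked.
  by case: (q b) => [[]|].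
by move=> b b' i qb _; have := qr b; rewrite qb /= orbF.
Qed.

Lemma tuple_size_root d x : rooted (Some x) q -> (forall b, delta b < d) ->
  (tuple_size (tuple_code q id d x)).+1 = #|B|.
Proof.
move=> qr; case: d => [|d] dd; first by have := dd x.
have qx : q x = None by have := qr x; rewrite eqxx.
have qN b : q b = None -> b = x.
  have := qr b; case: eqP => [[->//]|_]; by case: (q b).
have l0 : level 0 = [set x].
  apply/setP=> b; rewrite !inE q_ranked.
  case qb: (q b) => [[b' i]|]; last by rewrite (qN _ qb) !eqxx.
  by apply/esym/eqP=> bx; rewrite bx qx in qb.
have := @next_level _ id d 0 (@inj_id _).
rewrite l0 big_set1 => -> //; last by move=> b b' i _ _; exists i.
rewrite level_sizes.
  rewrite -(@sum_level d.+2); last by move=> b; apply: leqW.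
  by rewrite [RHS]big_ord_recl l0 cards1.
move=> b b' i qb b'0; have := qr b; case: eqP => [_|]; first by rewrite qb.
rewrite qb /= => _ /orP[//|/eqP[xb]].
by move: b'0; rewrite -xb q_ranked qx.
Qed.

End Levels.

End Codes.

(** * Isomorphism of forests with equal codes *)

Section Matching.
Variables (k : nat) (B : finType) (C : eqType).
Variables (q q' : B -> port k B) (delta : B -> nat) (c c' : B -> C).
Hypothesis q_ranked : ranked q delta.
Hypothesis match_root : forall a,
  #|[set b | (q b == None) && (c b == a)]| = #|[set b | (q' b == None) && (c' b == a)]|.
Hypothesis match_step : forall b b', c b = c' b' -> forall i a,
  #|[set x | (q x == Some (b, i)) && (c x == a)]| =
  #|[set x | (q' x == Some (b', i)) && (c' x == a)]|.

Definition children (r : B -> port k B) p : {set B} := [set b | r b == p].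

Variable b0 : B.

(** The isomorphism is built from the root downwards: the children of a vertex
    are matched with the children of its image by their colours. The first
    argument is the depth of b. *)
Fixpoint match_at (n : nat) (b : B) : B :=
  let p' := if n is n'.+1 then port_map (match_at n') (q b) else None in
  fiber_match (children q (q b)) (children q' p') c c' b0 b.

Definition match_vertex b := match_at (delta b) b.

Lemma match_vertexE b : match_vertex b =
  fiber_match (children q (q b)) (children q' (port_map match_vertex (q b))) c c' b0 b.
Proof.
rewrite {1}/match_vertex; have := q_ranked b.
case qb: (q b) => [[b' i]|] -> /=; rewrite qb //.
Qed.

Lemma card_children b :
  (forall b' i, q b = Some (b', i) -> c' (match_vertex b') = c b') -> forall a,
  #|[set x in children q (q b) | c x == a]| =
  #|[set x in children q' (port_map match_vertex (q b)) | c' x == a]|.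
Proof.
have chE (r : B -> port k B) (f : B -> C) p a :
    [set x in children r p | f x == a] = [set x | (r x == p) && (f x == a)].
  by apply/setP=> x; rewrite !inE.
move=> H a; rewrite !chE; case: (q b) H => [[b' i] H|_]; last exact: match_root.
by apply: match_step; rewrite (H b' i).
Qed.

Lemma match_vertexP b :
  q' (match_vertex b) = port_map match_vertex (q b) /\ c' (match_vertex b) = c b.
Proof.
have [n] := ubnP (delta b); elim: n b => // n IH b /ltnSE bn.
have cE := @card_children b _.
have bA : b \in children q (q b) by rewrite inE.
have [|+ cb] := fiber_matchP b0 (cE _) bA.
  move=> b' i qb; have := q_ranked b; rewrite qb => db.
  by case: (IH b'); rewrite -?db.
by rewrite -match_vertexE in cb *; rewrite inE => /eqP.
Qed.

Lemma match_vertex_inj : injective match_vertex.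
Proof.
move=> b1 b2; have [n] := ubnP (delta b1); elim: n b1 b2 => // n IH b1 b2 /ltnSE bn E.
have [q1 c1] := match_vertexP b1; have [q2 c2] := match_vertexP b2.
have qE : q b1 = q b2.
  move: q2; rewrite -E q1; have := q_ranked b1.
  case: (q b1) => [[b i]|]; case: (q b2) => [[b' i']|] //= db [mb ->].
  by rewrite (IH b b') // -db.
have cE := @card_children b1 (fun b' _ _ => (match_vertexP b').2).
move: E; rewrite !match_vertexE -qE => /(fiber_match_inj cE); apply; rewrite inE //.
by rewrite qE.
Qed.

End Matching.

Section Isomorphism.
Variables (k N : nat) (B : finType).
Variables (q q' : B -> port k B) (delta delta' : B -> nat) (v v' : option B) (d : nat).
Hypothesis BN : #|B| <= N.
Hypothesis (q_ranked : ranked q delta) (q'_ranked : ranked q' delta').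
Hypothesis (q_rooted : rooted v q) (q'_rooted : rooted v' q').
Hypothesis (d_lt : forall b, delta b < d) (d'_lt : forall b, delta' b < d).

(** The depth to which the code of the whole tree records what is below b. *)
Definition depth_left (B : finType) (v : option B) (delta : B -> nat) (b : B) : nat :=
  d - (delta b + (v == None)).

(** The colour of a vertex is its code together with the depth of that code,
    which decreases by one from a vertex to its children; the root black
    vertex, if any, has a colour of its own. *)
Definition colour (B : finType) (q : B -> port k B) (v : option B) (delta : B -> nat) b :
    option {l : nat & {ffun 'I_k -> utree k N l}} :=
  if v == Some b then None
  else Some (Tagged (fun l => {ffun 'I_k -> utree k N l})
                    (black_code N q (depth_left v delta b) b)).

(** The code below a port counts the children of the port by colour. *)
Lemma colour_children (r r' : B -> port k B) u u' e e' l p p' :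
  code N r l p = code N r' l p' ->
  (forall b, r b = p -> [/\ u != Some b, depth_left u e b = l.-1 & 0 < l]) ->
  (forall b, r' b = p' -> [/\ u' != Some b, depth_left u' e' b = l.-1 & 0 < l]) ->
  forall a, #|[set b | (r b == p) && (colour r u e b == a)]| =
            #|[set b | (r' b == p') && (colour r' u' e' b == a)]|.
Proof.
move=> E H H' a; case: l E H H' => [|l] E H H'.
  rewrite !eq_card0 // => b; rewrite inE; apply/negP=> /andP[/eqP].
    by case/H'.
  by case/H.
have colE (s : B -> port k B) w f t : (forall b, s b = t -> [/\ w != Some b, depth_left w f b =
    l & 0 < l.+1]) ->
    [set b | (s b == t) && (colour s w f b == a)] =
    [set b | (s b == t) && (Some (Tagged (fun l => {ffun 'I_k -> utree k N l}) (black_code N s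
        l b)) == a)].
  move=> Hs; apply/setP=> b; rewrite !inE; case: eqP => //= /Hs[/negPf nv dl _].
  by rewrite /colour nv dl.
rewrite (colE _ _ _ _ H) (colE _ _ _ _ H') {colE}.
case: a => [[l' f]|]; last first.
  by rewrite !eq_card0 // => b; rewrite inE andbF.
have [ll'|ll'] := eqVneq l l'; last first.
  rewrite !eq_card0 // => b; rewrite inE; apply/negP=> /andP[_ /eqP[ll _]];
  by rewrite ll eqxx in ll'.
subst l'.
have tagE (s : B -> port k B) t :
    [set b | (s b == t) && (Some (Tagged (fun l => {ffun 'I_k -> utree k N l}) (black_code N s
        l b)) == Some (existT _ l f))]
    = [set b | (s b == t) && (black_code N s l b == f)].
  apply/setP=> b; rewrite !inE; congr (_ && _).
  exact: (@eq_Tagged _ (fun l => {ffun 'I_k -> utree k N l} : eqType) (Tagged _ (black_code N s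
      l b)) f).
by rewrite !tagE -!codeK // E.
Qed.

Hypothesis same_code :
  match v, v' with
  | None, None => code N q d None = code N q' d None
  | Some x, Some x' => tuple_code N q id d x = tuple_code N q' id d x'
  | _, _ => False
  end.

(** Vertices of equal colour have equally many children of each colour in each
    position, so that the matching of colours from the root downwards is an
    isomorphism. *)
Theorem code_iso : exists mu : {perm B}, (forall b, q' (mu b) = port_map mu (q b)) /\ v' = omap
    mu v.
Proof.
have [b0 _|B0] := pickP (mem B); last first.
  exists 1%g; split=> [b|]; first by have := B0 b.
  by case: v v' same_code => [x|] [x'|] //; have := B0 x.
have vN : (v == None) = (v' == None) by case: v v' same_code => [x|] [x'|].
have root (r : B -> port k B) u e b x i : ranked r e -> rooted u r ->
    (forall b, e b < d) -> r b = Some (x, i) ->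
    [/\ u != Some b, e b = (e x).+1 & e b + (u == None) <= d].
  move=> re ru ed rb; have := re b; rewrite rb => eb; have := ru b; rewrite rb.
  case: eqP => // uN _; split=> //.
  by case: (u == None); rewrite ?addn1 ?addn0 ?ed // ltnW.
have mroot a : #|[set b | (q b == None) && (colour q v delta b == a)]| =
    #|[set b | (q' b == None) && (colour q' v' delta' b == a)]|.
  move: same_code q_rooted q'_rooted; rewrite /rooted.
  case: v v' vN => [x|] [x'|] //= _ E qr q'r; last first.
    apply: (@colour_children _ _ _ _ _ _ d) => // b rb; rewrite /depth_left.
      have := d_lt b; have := q_ranked b; rewrite rb => ->; split=> //.
      by rewrite add0n subn1.
    have := d'_lt b; have := q'_ranked b; rewrite rb => ->; split=> //.
    by rewrite add0n subn1.
  have single (r : B -> port k B) (e : B -> nat) y : rooted (Some y) r ->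
      #|[set b | (r b == None) && (colour r (Some y) e b == a)]| = (a == None).
    move=> ry; case: (eqVneq a None) => [->|aN].
      rewrite (_ : [set b | _] = [set y]) ?cards1 //; apply/setP=> b; rewrite !inE /colour.
      have := ry b; case: eqP => [[->] ->|yb]; first by rewrite !eqxx.
      by case: (r b) => [p|] //= _; apply/esym/eqP=> E1; rewrite E1 in yb.
    apply/eqP; rewrite cards_eq0; apply/eqP/setP=> b; rewrite !inE /colour.
    have := ry b; case: eqP => [_ ->|yb]; last by case: (r b).
    by rewrite eqxx /= eq_sym (negPf aN).
  by rewrite !single.
have mstep b b' : colour q v delta b = colour q' v' delta' b' -> forall i a,
    #|[set x | (q x == Some (b, i)) && (colour q v delta x == a)]| =
    #|[set x | (q' x == Some (b', i)) && (colour q' v' delta' x == a)]|.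
  move=> cE i a; move: cE; rewrite /colour.
  case: (eqVneq v (Some b)) => [vb|vb]; case: (eqVneq v' (Some b')) => [vb'|vb'] //.
    move=> _; move: same_code q_rooted q'_rooted q_ranked q'_ranked.
    rewrite vb vb' => E qr q'r qra q'ra.
    have {}E : code N q d (Some (b, i)) = code N q' d (Some (b', i)).
      by have := congr1 (fun f : {ffun _ -> _} => f i) E; rewrite !ffunE.
    have H (r : B -> port k B) e y x : ranked r e -> rooted (Some y) r -> (forall b, e b < d) ->
        r x = Some (y, i) -> [/\ Some y != Some x, depth_left (Some y) e x = d.-1 & 0 < d].
      move=> re ry ed rx; have [y1 y2 y3] := root _ _ _ _ _ _ re ry ed rx.
      split=> //; last by apply: leq_ltn_trans (ed x).
      rewrite /depth_left y2 addn0; have := re y; have := ry y; rewrite eqxx => -> ->.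
      by rewrite subn1.
    apply: (@colour_children _ _ _ _ _ _ d) => // x; rewrite ?vb ?vb'.
      exact: H.
    exact: H.
  move=> /Some_inj cE; have lE := congr1 tag cE; rewrite /= in lE.
  move: cE; rewrite -lE => /eqP; rewrite eq_Tagged /= => /eqP tE.
  (* Position k+1 of a vertex with a parent has no children. *)
  have [i0|i0] := eqVneq i 0%R.
    have H (r : B -> port k B) u y x : rooted u r -> u != Some y -> r x != Some (y, i).
      move=> ru uy; apply/eqP=> rx; have := ru x; rewrite rx i0 /= (negPf uy).
      by case: ifP.
    rewrite !eq_card0 // => x; rewrite inE.
      by rewrite (negPf (H _ _ _ _ q'_rooted vb')).
    by rewrite (negPf (H _ _ _ _ q_rooted vb)).
  have [j ij] : exists j, i = lift ord0 j.
    by case: (unliftP ord0 i) i0 => [j ->|->] //; exists j.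
  have H (r : B -> port k B) e u y x : ranked r e -> rooted u r -> (forall b, e b < d) ->
      r x = Some (y, i) ->
      [/\ u != Some x, depth_left u e x = (depth_left u e y).-1 & 0 < depth_left u e y].
    move=> re ru ed rx; have [y1 y2 y3] := root _ _ _ _ _ _ re ru ed rx.
    by split=> //; rewrite /depth_left; lia.
  apply: (@colour_children _ _ _ _ _ _ (depth_left v delta b)) => [|x|x].
  - by have := congr1 (fun f : {ffun _ -> _} => f j) tE; rewrite !ffunE ij.
  - exact: H.
  - by rewrite lE; exact: H.
have [mu muE] : exists mu : {perm B}, forall b, q' (mu b) = port_map mu (q b).
  exists (perm (@match_vertex_inj _ _ _ _ _ _ _ _ q_ranked mroot mstep b0)) => b.
  rewrite permE (match_vertexP q_ranked mroot mstep b0 b).1.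
  by case: (q b) => [[b' i]|] //=; rewrite permE.
exists mu; split=> //.
case: v v' vN q_rooted q'_rooted => [x|] [x'|] //= _ qr q'r.
have := muE x; have := qr x; rewrite eqxx => -> /= E.
by have := q'r (mu x); case: eqP => [[->]|_]; rewrite ?E.
Qed.
End Isomorphism.

(** * Realization of unlabelled trees *)

Section Realisation.
Variables k N : nat.
Notation utree := (utree k N).

Record forest := Forest {
  fvertex :> finType;
  fparent : fvertex -> port k fvertex;
  fdepth : fvertex -> nat }.

Record realises (F : forest) d (u : utree d) : Prop := Realises {
  realises_ranked : ranked (@fparent F) (@fdepth F);
  realises_rooted : rooted None (@fparent F);
  realises_code : code N (@fparent F) d None = u;
  realises_card : #|F| = usize u }.

Section Graft.
Variables (d : nat) (S : utree d -> forest).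
Hypothesis S_ok : forall u, realises (S u) u.
Variables (I J : finType) (ports : I -> 'I_k.+1) (f : J -> {ffun I -> utree d}).
Hypothesis ports_inj : injective ports.

(** The black vertices j : J are new roots, and a copy of the forest S (f j i)
    is grafted in position [ports i] at j. *)
Definition gvertex : finType := (J + {ji : J * I & S (f ji.1 ji.2)})%type.

Definition gin (ji : J * I) (b : S (f ji.1 ji.2)) : gvertex :=
  inr (Tagged (fun ji => S (f ji.1 ji.2) : finType) b).

Definition gport (ji : J * I) (p : port k (S (f ji.1 ji.2))) : port k gvertex :=
  if p is Some (b, i) then Some (gin b, i) else Some (inl ji.1, ports ji.2).

Definition gparent (b : gvertex) : port k gvertex :=
  match b with
  | inl _ => None
  | inr (existT ji c) => gport (fparent c)
  end.

Definition gdepth (b : gvertex) : nat :=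
  match b with
  | inl _ => 0
  | inr (existT ji c) => (fdepth c).+1
  end.

Lemma gin_inj ji : injective (@gin ji).
Proof. by move=> b b' [/eqP]; rewrite eq_Tagged => /eqP. Qed.

Lemma graft_ranked : ranked gparent gdepth.
Proof.
move=> [j|[ji c]] //=; rewrite (realises_ranked (S_ok _)) /gport.
by case: (fparent c) => [[c' i]|].
Qed.

Lemma graft_parent b b' i : gparent b = Some (b', i) ->
  i <> 0%R \/ exists2 j, b' = inl j & exists i', i = ports i'.
Proof.
case: b => [j|[ji c]] //=; rewrite /gport.
have := realises_rooted (S_ok (f ji.1 ji.2)) c; rewrite /=.
case: (fparent c) => [[c' i']|] /=.
  by rewrite orbF => /eqP i0 [_ <-]; left.
by move=> _ [<- <-]; right; exists ji.1 => //; exists ji.2.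
Qed.

Lemma graft_root b : gparent b = None <-> exists j, b = inl j.
Proof.
split=> [|[j ->] //]; case: b => [j|[ji c]] /=; first by exists j.
by rewrite /gport; case: (fparent c) => [[]|].
Qed.

Lemma graft_code j : tuple_code N gparent ports d (inl j) = f j.
Proof.
apply/ffunP=> i; rewrite ffunE.
pose ji := (j, i); rewrite -(realises_code (S_ok (f ji.1 ji.2))).
have H := @code_embed k N _ _ (@fparent (S (f ji.1 ji.2))) gparent (@gin ji)
            (Some (inl j, ports i)) (@gin_inj ji).
apply: (H _ d None) => p b'; split=> [|[b -> <-]] /=; last by rewrite /gport;
    case: (fparent b) => [[]|].
case: b' => [j'|[ji' c]] /=; first by case: p => [[]|].
(* Equality of positions first identifies the copy in which c lies. *)
have ind x (c' : S (f x.1 x.2)) : x = ji -> gport (fparent c') = (if p is Some (b, i1) then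
    Some (gin b, i1) else Some (inl j, ports i)) ->
    exists2 b, gin c' = gin b & fparent b = p.
  move=> xji; subst x; rewrite /gport => E; exists c' => //.
  case: (fparent c') p E => [[c1 i1]|] [[b i2]|] //.
  by move=> [/eqP]; rewrite eq_Tagged => /eqP /= -> ->.
move=> E; apply: ind => //; move: E; rewrite /gport.
case: (fparent c) p => [[c1 i1]|] [[b i2]|] // [] //.
by move=> jj /ports_inj ii; rewrite [ji']surjective_pairing jj ii.
Qed.

Lemma graft_card : #|gvertex| = \sum_j (tuple_size (f j)).+1.
Proof.
rewrite card_sum card_tagged sumnE big_map big_enum /=.
under [RHS]eq_bigr do rewrite -addn1 addnC.
rewrite big_split /= sum1_card; congr (_ + _).
rewrite pair_big /=; apply: eq_bigr => ji _; exact: realises_card.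
Qed.

End Graft.

Theorem realise d (u : utree d) : exists F, realises F u.
Proof.
elim: d u => [|d IH] u.
  exists (@Forest void (fun=> None) (fun=> 0)); split=> //; first by case: u.
  by rewrite card_void.
have [S SP] := choice IH.
pose J : finType := {a : {ffun 'I_k -> utree d} & 'I_((u : {ffun _ -> 'I_N.+1}) a)}.
pose f (j : J) := tag j.
have pI : injective (lift ord0 : 'I_k -> 'I_k.+1) by exact: lift_inj.
have gc := graft_code SP f pI.
exists (@Forest (gvertex S f) (@gparent _ S _ _ (lift ord0) f) (@gdepth _ S _ _ f)); split.
- exact: graft_ranked.
- move=> b /=; case gb: (gparent _ b) => [[b' i]|] //=; rewrite orbF.
  have [/eqP//|[j _ [i' ->]]] := graft_parent SP gb.
  by rewrite eq_sym neq_lift.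
- apply/ffunP=> a; rewrite codeE.
  have inlI : injective (inl : J -> gvertex S f) by move=> ? ? [].
  have tI : injective (fun r : 'I_((u : {ffun _ -> 'I_N.+1}) a) => Tagged _ r : J).
    by move=> r r' /eqP; rewrite eq_Tagged => /eqP.
  rewrite (_ : #|_| = (u : {ffun _ -> 'I_N.+1}) a) ?inord_val //.
  rewrite -[RHS]card_ord -(card_imset _ tI) -(card_imset _ inlI).
  apply: eq_card => b; rewrite inE; apply/andP/imsetP => [[/eqP/graft_root[j ->]]|].
    rewrite /black_code gc /f => /eqP ja; exists j => //; apply/imsetP.
    by case: j ja => a' r /= ja; subst a'; exists r.
  by case=> j /imsetP[r _ ->] ->; rewrite /black_code gc.
- rewrite usizeE /= (graft_card SP) -(@sig_big_dep _ _ _ _ _ xpredT (fun=> xpredT) (fun a _ =>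
    (tuple_size a).+1)) /=.
  by apply: eq_bigr => a _; rewrite sum_nat_const card_ord.
Qed.

Section Relabel.
Variables (B : finType) (q : B -> port k B) (delta : B -> nat) (m : nat).
Hypotheses (q_ranked : ranked q delta) (Bm : #|B| = m).

Lemma relabel : exists (f : B -> 'I_m) (q' : 'I_m -> port k 'I_m) delta',
  [/\ bijective f, ranked q' delta', forall b, q' (f b) = port_map f (q b)
    & forall d p, code N q' d (port_map f p) = code N q d p].
Proof.
have [phi [psi phiK psiK]] : exists phi : B -> 'I_m, exists2 psi, cancel phi psi & cancel psi phi.
  exists (fun b => cast_ord Bm (enum_rank b)), (fun i => enum_val (cast_ord (esym Bm) i)).
    by move=> b; rewrite cast_ordK enum_rankK.
  by move=> i; rewrite enum_valK cast_ordKV.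
exists phi, (fun i => port_map phi (q (psi i))), (fun i => delta (psi i)); split.
- by exists psi.
- by move=> i; rewrite q_ranked; case: (q _) => [[b j]|] //=; rewrite phiK.
- by move=> b; rewrite phiK.
move=> d p; have H := @code_embed k N _ _ q (fun i => port_map phi (q (psi i))) phi None
  (can_inj phiK).
have pE (p' : port k B) : port_map phi p' = if p' is Some (b, i) then Some (phi b, i) else None.
  by case: p' => [[]|].
rewrite pE H // => p' i; rewrite -pE; split=> [E|[b -> <-]]; last by rewrite phiK.
exists (psi i); rewrite ?psiK //.
have phiI := can_inj phiK.
by move: E; case: (q _) p' => [[b j]|] [[b' j']|] //= [] /phiI-> ->.
Qed.
End Relabel.

Theorem realiseY m d (u : utree d) : usize u = m ->
  exists (q : 'I_m -> port k 'I_m) delta,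
    [/\ ranked q delta, rooted None q & code N q d None = u].
Proof.
move=> um; have [F [rF oF cF sF]] := realise u.
have [f [q [delta [[g fK gK] qr qf qc]]]] := relabel rF (etrans sF um).
exists q, delta; split=> // [i|]; last by rewrite (qc d None).
rewrite -[i]gK /= qf; have := oF (g i); rewrite /=.
by case: (fparent _) => [[b j]|].
Qed.

Theorem realiseXY m d (a : {ffun 'I_k.+1 -> utree d}) : (tuple_size a).+1 = m ->
  exists (q : 'I_m -> port k 'I_m) delta x,
    [/\ ranked q delta, rooted (Some x) q & tuple_code N q id d x = a].
Proof.
move=> am; have [S SP] := choice (@realise d).
pose f (_ : unit) := a.
have idI : injective (id : 'I_k.+1 -> _) by [].
have gr := @graft_ranked d S SP _ _ id f.
have gc := graft_code SP f idI tt.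
have card_g : #|gvertex S f| = m by rewrite (graft_card SP) (big_pred1 tt) // => -[].
have [h [q [delta [[g hK gK] qr qf qc]]]] := relabel gr card_g.
exists q, delta, (h (inl tt)); split=> // [i|].
  rewrite -[i]gK qf (inj_eq (@Some_inj _)) (inj_eq (can_inj hK)).
  have [<- //|ne] := eqVneq (inl tt) (g i).
  case qi: (gparent _ (g i)) => [[b j]|] /=.
    have [/eqP->//|[[] -> _]] := graft_parent SP qi.
    by rewrite eqxx orbT.
  by have /graft_root[[] gi] := qi; rewrite gi eqxx in ne.
apply/ffunP=> i; rewrite ffunE -[a]/(f tt) -gc ffunE.
exact: (qc d (Some (inl tt, i))).
Qed.

End Realisation.

(** * Coding trees as forests of black vertices *)

Section Frames.
Variables (k : nat) (B W : finType).
Implicit Types (t : ctree k B W) (v : option B) (w : W) (b : B)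
  (lin : B -> ordering k W) (q : B -> port k B) (delta : B -> nat).

Definition base v w : B + W := if v is Some x then inl x else inr w.

(** The pair (b', i) found here is the one used by [twist] at b. *)
Definition graph_port t (v0 : B + W) w0 b : port k B :=
  if [pick u : W * B | toward t v0 (inl b) (inr u.1) &&
                       toward t v0 (inr u.1) (inl u.2)] is Some (w, b')
  then Some (b', position t v0 w0 b' w) else None.

Definition port_white lin w0 (p : port k B) : W :=
  if p is Some (b, i) then lin b i else w0.

(** The correspondence between a rooted coding tree t and a forest q:
    [port_white] identifies the valid ports with the white vertices, and lin
    is the linearization of the cyclic orders that puts the parent in position
    k+1. Every coding tree has a frame ([graph_frame]), and a frame determines
    lin and q ([frame_linear], [frame_graph_port]), so it suffices to exhibit
    frames in order to compute these after relabelling or twisting. *)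
Record frame t v w0 lin q delta : Prop := Frame {
  frame_edges : forall b w, ((b, w) \in edges t) = [exists i, lin b i == w];
  frame_cyc : forall b, cyc t b = rotations (lin b);
  frame_ranked : ranked q delta;
  frame_rooted : rooted v q;
  frame_inj : forall p p', valid v p -> valid v p' ->
    port_white lin w0 p = port_white lin w0 p' -> p = p';
  frame_surj : forall w, exists2 p, valid v p & port_white lin w0 p = w;
  frame_last : forall b, lin b 0%R = if v == Some b then w0 else port_white lin w0 (q b) }.

Lemma rotationsP (f g : ordering k W) :
  reflect (exists i, forall a, g a = f (a + i)%R) (g \in rotations f).
Proof.
apply: (iffP imsetP) => [[i _ ->]|[i gE]]; exists i => //.
  by move=> a; rewrite ffunE.
by apply/ffunP=> a; rewrite ffunE.
Qed.

Lemma rotations_eq (f g : ordering k W) : g \in rotations f -> rotations g = rotations f.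
Proof.
case/rotationsP=> i gE; apply/setP=> h; apply/rotationsP/rotationsP => [[j hE]|[j hE]].
  by exists (j + i)%R => a; rewrite hE gE addrA.
by exists (j - i)%R => a; rewrite hE gE -addrA subrK.
Qed.

Lemma adj_irr t : irreflexive (adj t). Proof. by case. Qed.

Lemma adj_sym t : symmetric (adj t). Proof. by move=> [a|a] [c|c]. Qed.

(** Valid positions name different white vertices, and a non-valid one holds
    the parent, which is not among the children by the rank. *)
Lemma frame_lin_inj t v w0 lin q delta b :
  frame t v w0 lin q delta -> injective (lin b).
Proof.
move=> F.
have aux i j : valid v (Some (b, i)) -> lin b i = lin b j -> i = j.
  move=> vi E; have [vj|] := boolP (valid v (Some (b, j))).
    by have [] := frame_inj F vi vj E.
  rewrite /= negb_or negbK => /andP[/eqP j0 nv].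
  move: E; rewrite j0 (frame_last F) (negPf nv) => E.
  have vq : valid v (q b) by have := frame_rooted F b; rewrite (negPf nv).
  have Eq := frame_inj F vi vq E.
  by have := frame_ranked F b; rewrite -Eq => /n_Sn.
move=> i j E; have [vi|] := boolP (valid v (Some (b, i))); first exact: aux.
have [vj|] := boolP (valid v (Some (b, j))); first by rewrite (aux j i).
by rewrite /= !negb_or !negbK => /andP[/eqP -> _] /andP[/eqP -> _].
Qed.

Section FrameToGraph.
Variables (t : ctree k B W) (v : option B) (w0 : W) (lin : B -> ordering k W).
Variables (q : B -> port k B) (delta : B -> nat).
Hypothesis F : frame t v w0 lin q delta.

Let v0 := base v w0.

Definition parent : rel (B + W) := fun x y =>
  match x, y with
  | inl b, inr w => (v != Some b) && (lin b 0%R == w)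
  | inr w, inl b => [exists i, valid v (Some (b, i)) && (lin b i == w)]
  | _, _ => false
  end.

Definition port_of (w : W) : port k B :=
  odflt None [pick p | valid v p && (port_white lin w0 p == w)].

Lemma port_ofP w : valid v (port_of w) /\ port_white lin w0 (port_of w) = w.
Proof.
rewrite /port_of; case: pickP => [p /andP[vp /eqP pw] //|H].
by have [p vp pw] := frame_surj F w; have := H p; rewrite vp pw eqxx.
Qed.

Lemma port_ofE p w : valid v p -> port_white lin w0 p = w -> port_of w = p.
Proof. by have [vw ww] := port_ofP w => vp pw; apply: (frame_inj F); rewrite ?ww. Qed.

(** Passing to the black vertex two steps up decreases the height by 2. With a
    white root, the black vertices next to it have height 1. *)
Definition black_height b := (delta b).*2 + (v == None).
Definition height (x : B + W) : nat :=
  match x with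
  | inl b => black_height b
  | inr w => if port_of w is Some (b, _) then (black_height b).+1 else 0
  end.

Lemma valid_q b : v != Some b -> valid v (q b).
Proof. by move=> vb; have := frame_rooted F b; rewrite (negPf vb). Qed.

(** With [rooted_tree] this shows that t is a tree and that [toward] is
    [parent]. *)
Lemma frame_rooted_by : rooted_by (adj t) v0 parent height.
Proof.
split.
- have H b w : ((b, w) \in edges t) = parent (inl b) (inr w) || parent (inr w) (inl b).
    rewrite (frame_edges F);
        apply/existsP/orP => [[i /eqP iw]|[/andP[_ /eqP bw]|/existsP[i /andP[_ iw]]]].
    - have [vi|] := boolP (valid v (Some (b, i))).
        by right; apply/existsP; exists i; rewrite vi iw eqxx.
      rewrite /= negb_or negbK => /andP[/eqP i0 nv]; left.
      by rewrite nv -iw i0 eqxx.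
    - by exists 0%R; apply/eqP.
    - by exists i.
  by move=> [b|w] [b'|w'] //; rewrite /adj H // orbC.
- move=> [b|w] [b'|w'] //=.
    move=> /andP[nv /eqP <-]; rewrite (frame_last F) (negPf nv).
    rewrite (port_ofE (valid_q nv) erefl) /black_height (frame_ranked F b).
    have := valid_q nv; case: (q b) => [[b' i]|] /= vq; first by rewrite doubleS !addSn.
    by rewrite vq.
  by case/existsP=> i /andP[vi /eqP wi]; rewrite (@port_ofE (Some (b', i))).
- move=> [b|w] [b1|w1] [b2|w2] //=.
    by move=> /andP[_ /eqP <-] /andP[_ /eqP <-].
  case/existsP=> i /andP[vi /eqP wi] /existsP[j /andP[vj /eqP wj]].
  have : Some (b1, i) = Some (b2, j) :> port k B.
    by apply: (frame_inj F) => //=; rewrite wi wj.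
  by case=> ->.
- move=> [b|w] nb.
    exists (inr (lin b 0%R)); rewrite /= eqxx andbT.
    by apply: contraNneq nb; rewrite /v0 => ->.
  have [] := port_ofP w; case: (port_of w) => [[b i]|] /= vp.
    by move=> <-; exists (inl b); apply/existsP; exists i; rewrite vp eqxx.
  by move=> E; move: nb; rewrite /v0 (eqP vp) /= E eqxx.
- rewrite /v0; case ve: v => [x|] [b|w] //=; first by rewrite ve eqxx.
  apply/existsP=> -[i /andP[vi /eqP wi]].
  have : Some (b, i) = None :> port k B.
    by apply: (frame_inj F) => //=; rewrite ve.
  by [].
- rewrite /v0; case ve: v => [x|] /=.
    rewrite /black_height (frame_ranked F) ve; have := frame_rooted F x.
    by rewrite ve eqxx => ->.
  by rewrite (@port_ofE None) //= ve.
Qed.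

Lemma frame_toward x y : toward t v0 x y = parent x y.
Proof. by have [_ H] := rooted_tree frame_rooted_by; rewrite -H. Qed.

Lemma frame_last_nbr b : last_nbr t v0 w0 b = lin b 0%R.
Proof.
rewrite /last_nbr; case: pickP => [w|H] /=.
  by rewrite frame_toward => /andP[_ /eqP].
rewrite (frame_last F); case: eqP => // /eqP nv.
by have := H (lin b 0%R); rewrite frame_toward /= nv eqxx.
Qed.

Lemma frame_linear b : Defs.linear t v0 w0 b = lin b.
Proof.
rewrite /Defs.linear frame_last_nbr (frame_cyc F); case: pickP => [f|H] /=.
  case/andP=> /rotationsP[i fE] /eqP f0; apply/ffunP=> a.
  move: f0; rewrite fE add0r => /(frame_lin_inj F) i0.
  by rewrite fE i0 addr0.
have := H (lin b); rewrite eqxx andbT; case/rotationsP.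
by exists 0%R => a; rewrite addr0.
Qed.

Lemma frame_position b i : position t v0 w0 b (lin b i) = i.
Proof.
rewrite /position frame_linear; case: pickP => [j /eqP /(frame_lin_inj F) //|].
by move/(_ i); rewrite eqxx.
Qed.

Lemma frame_graph_port b : graph_port t v0 w0 b = q b.
Proof.
rewrite /graph_port; case: pickP => [[w b']|H] /=; rewrite ?frame_toward.
  case/andP=> /andP[nv /eqP <-] /existsP[i /andP[vi /eqP bi]].
  rewrite -bi frame_position.
  by apply: (frame_inj F) => //; [exact: valid_q | rewrite /= bi (frame_last F) (negPf nv)].
have := frame_rooted F b; case: eqP => [_ //|/eqP nv vq].
case qb: (q b) vq => [[b' i]|] // vq.
have := H (lin b 0%R, b'); rewrite !frame_toward /= nv eqxx /=.
case/existsP; exists i; rewrite -[_ || _]/(valid v (Some (b', i))) vq /=.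
by rewrite (frame_last F) (negPf nv) qb eqxx.
Qed.

Lemma frame_is_coding_tree : is_coding_tree t.
Proof.
have [tr _] := rooted_tree frame_rooted_by.
rewrite /is_coding_tree tr; apply/forallP=> b.
have nE : [set lin b a | a in 'I_k.+1] = nbrs t b.
  apply/setP=> w; rewrite inE (frame_edges F); apply/imsetP/existsP => [[i _ ->]|[i /eqP <-]].
    by exists i.
  by exists i.
have li := frame_lin_inj (b := b) F.
rewrite -nE card_imset // card_ord eqxx /=; apply/existsP; exists (lin b).
by rewrite eqxx (frame_cyc F) eqxx andbT /= andbT; apply/injectiveP.
Qed.

End FrameToGraph.

Section GraphToFrame.
Variables (t : ctree k B W) (v : option B) (w0 : W).
Hypothesis t_tree : is_coding_tree t.
Hypothesis root_edge : forall x, v = Some x -> (x, w0) \in edges t.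

Let v0 := base v w0.
Let lin := Defs.linear t v0 w0.

(** The parent relation of the tree gives the depth: half of the height of a
    black vertex. *)
Lemma graph_frame : exists delta, frame t v w0 lin (graph_port t v0 w0) delta.
Proof.
have /andP[tr /forallP bl] := t_tree.
have [h R] := tree_rooted v0 (@adj_irr t) (@adj_sym t) tr.
have towE x y : toward t v0 x y = nearer (adj t) v0 x y by [].
have tow_adj x y : toward t v0 x y -> adj t x y by case/andP.
have nbrv b : v != Some b -> exists2 w, toward t v0 (inl b) (inr w) & last_nbr t v0 w0 b = w.
  move=> vb; rewrite /last_nbr; case: pickP => [w tw|H]; first by exists w.
  have : inl b != v0 by rewrite /v0 /base; case: (v) vb => // x; apply: contra => /eqP[->].
  move/(rooted_total R) => [[b'|w] bw]; first by have := tow_adj _ _ bw.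
  by have := H w; rewrite towE bw.
have nbrx b : v = Some b -> last_nbr t v0 w0 b = w0.
  move=> vb; rewrite /last_nbr; case: pickP => // w; rewrite towE /v0 vb /= => bw.
  by have := rooted_base R (inr w); rewrite /v0 vb /= bw.
have last_in b : last_nbr t v0 w0 b \in nbrs t b.
  rewrite inE; have [vb|vb] := eqVneq v (Some b); first by rewrite nbrx ?root_edge.
  by have [w /tow_adj bw ->] := nbrv _ vb.
have linP b : [/\ lin b 0%R = last_nbr t v0 w0 b, cyc t b = rotations (lin b),
    injective (lin b) & [set lin b a | a in 'I_k.+1] = nbrs t b].
  have /andP[_ /existsP[f /and3P[/injectiveP fI /eqP fn /eqP cf]]] := bl b.
  have [i _ li] : exists2 i, i \in 'I_k.+1 & last_nbr t v0 w0 b = f i.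
    by apply/imsetP; rewrite fn last_in.
  rewrite /lin /Defs.linear cf; case: pickP => [g|H] /=; last first.
    have := H [ffun a => f (a + i)%R]; rewrite ffunE add0r -li eqxx andbT.
    by case/rotationsP; exists i => a; rewrite ffunE.
  case/andP=> gf /eqP g0; rewrite (rotations_eq gf); split=> //.
    by case/rotationsP: gf => j gE a a'; rewrite !gE => /fI /addIr.
  case/rotationsP: gf => j gE; rewrite -fn; apply/setP=> w.
  apply/imsetP/imsetP=> -[a _ ->]; first by exists (a + j)%R; rewrite ?gE.
  by exists (a - j)%R; rewrite // gE subrK.
have lin0 b : lin b 0%R = last_nbr t v0 w0 b by case: (linP b).
have linI b : injective (lin b) by case: (linP b).
have edgeE b w : ((b, w) \in edges t) = [exists i, lin b i == w].
  have [_ _ _ /setP/(_ w)] := linP b; rewrite [in RHS]inE => <-.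
  by apply/imsetP/existsP=> [[i _ ->]|[i /eqP<-]]; exists i.
have posE b i : position t v0 w0 b (lin b i) = i.
  rewrite /position -/lin; case: pickP => [j /eqP /linI //|].
  by move/(_ i); rewrite eqxx.
(* A non-valid position at b is position k+1 of a vertex with a parent, and
   that position is taken by the parent. *)
have up_valid w b i : toward t v0 (inr w) (inl b) -> lin b i = w -> valid v (Some (b, i)).
  move=> wb bi; rewrite /=; case: eqP => //= i0.
  apply/negPn/negP=> vb; have [w' bw' lw'] := nbrv _ vb.
  move: bw'; rewrite -lw' -lin0 -i0 bi => bw.
  have := rooted_height R bw; rewrite (rooted_height R wb) => /eqP.
  by rewrite -addn2 -{1}[h _]addn0 eqn_add2l.
have up_pos w b : toward t v0 (inr w) (inl b) -> exists2 i, lin b i = w & valid v (Some (b, i)).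
  move=> wb; have := tow_adj _ _ wb; rewrite /= edgeE => /existsP[i /eqP bi].
  by exists i => //; apply: up_valid wb bi.
have valid_up b i : valid v (Some (b, i)) -> toward t v0 (inr (lin b i)) (inl b).
  move=> vi; have : adj t (inl b) (inr (lin b i)).
    by rewrite /= edgeE; apply/existsP; exists i.
  rewrite (rooted_adj R) => /orP[bw|//]; exfalso; move: vi => /=.
  have vb : v != Some b.
    apply/eqP=> vb; have := rooted_base R (inr (lin b i)).
    by rewrite /v0 vb /= => /negP; apply; move: bw; rewrite /v0 vb.
  rewrite (negPf vb) orbF => /eqP i0; have [w' bw' lw'] := nbrv _ vb.
  have := rooted_fun R bw bw'; case; rewrite -lw' -lin0 => /linI; exact: i0.
have qN b : v = Some b -> graph_port t v0 w0 b = None.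
  move=> vb; rewrite /graph_port; case: pickP => [[w b'] /= /andP[bw _]|//].
  by have := rooted_base R (inr w); rewrite /v0 vb /= => /negP; case; move: bw; rewrite /v0 vb.
have qS b : v != Some b ->
    [/\ valid v (graph_port t v0 w0 b), lin b 0%R = port_white lin w0 (graph_port t v0 w0 b) &
     (h (inl b))./2 = if graph_port t v0 w0 b is Some (b', _) then ((h (inl b'))./2).+1 else 0].
  move=> vb; have [w bw lw] := nbrv _ vb; rewrite lin0 lw.
  rewrite /graph_port; case: pickP => [[w' b'] /= /andP[bw' wb']|H].
    have [ww'] := rooted_fun R bw bw'; rewrite -{}ww' in wb' bw' *.
    have [i bi vi] := up_pos _ _ wb'; rewrite -bi posE; split=> //.
    by rewrite (rooted_height R bw) (rooted_height R wb').
  have E : inr w = v0 :> B + W.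
    apply/eqP/negPn/negP => /(rooted_total R)[[b'|w'] wb']; last by have := tow_adj _ _ wb'.
    by have := H (w, b'); rewrite /= bw towE wb'.
  move: (E); rewrite /v0; case: (v) => //= -[ww0]; split=> //.
  by rewrite (rooted_height R bw) E (rooted_zero R).
exists (fun b => (h (inl b))./2); split.
- exact: edgeE.
- by move=> b; case: (linP b).
- move=> b; have [vb|/qS[_ _]] := eqVneq v (Some b); last by [].
  by rewrite (qN _ vb); have := rooted_zero R; rewrite /v0 vb /= => ->.
- by move=> b; have [/qN|/qS[]] := eqVneq v (Some b).
- move=> [[b i]|] [[b' i']|] //.
  + move=> /valid_up b1 /valid_up b2 /= E; rewrite -E in b2.
    by have [bb] := rooted_fun R b1 b2; move: E; rewrite bb => /linI->.
  + move=> /valid_up b1 /= /eqP v_ E; rewrite E in b1.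
    by have := rooted_base R (inl b); rewrite /v0 v_ /= => /negP; case; move: b1; rewrite /v0 v_.
  + move=> /= /eqP v_ /valid_up b1 E; rewrite -E in b1.
    by have := rooted_base R (inl b'); rewrite /v0 v_ /= => /negP; case; move: b1; rewrite /v0 v_.
- move=> w; have [E|] := eqVneq (inr w) v0.
    exists None; first by move: E; rewrite /v0 /=; case: (v).
    by move: E; rewrite /v0 /base; case: (v) => // -[->].
  move/(rooted_total R) => [[b|w'] wb]; last by have := tow_adj _ _ wb.
  by have [i bi vi] := up_pos _ _ wb; exists (Some (b, i)).
- move=> b; have [vb|/qS[]//] := eqVneq v (Some b).
  by rewrite lin0 nbrx.
Qed.

End GraphToFrame.
End Frames.

(** * Relabelling, twisting and realizing coding trees *)

Section FrameMaps.
Variables (k : nat) (B W : finType).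
Variables (t : ctree k B W) (v : option B) (w0 : W) (lin : B -> ordering k W)
  (q : B -> port k B) (delta : B -> nat).
Hypothesis F : frame t v w0 lin q delta.

Lemma valid_map (mu : {perm B}) (p : port k B) : valid (omap mu v) (port_map mu p) = valid v p.
Proof.
case: p => [[b i]|] /=; last by case: (v).
by case: (v) => [x|] //=; rewrite !(inj_eq (@Some_inj _)) (inj_eq perm_inj).
Qed.

Lemma port_mapK (mu : {perm B}) : cancel (port_map mu : port k B -> _) (port_map mu^-1%g).
Proof. by case=> [[b i]|] //=; rewrite permK. Qed.

Lemma port_mapKV (mu : {perm B}) : cancel (port_map mu^-1%g : port k B -> _) (port_map mu).
Proof. by case=> [[b i]|] //=; rewrite permKV. Qed.

Lemma omap_eq (mu : {perm B}) b : (omap mu v == Some (mu b)) = (v == Some b).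
Proof. by case: (v) => //= x; rewrite !(inj_eq (@Some_inj _)) (inj_eq perm_inj). Qed.

Lemma frame_transport (mu : {perm B}) (nu : {perm W}) :
  frame (ct_transport mu nu t) (omap mu v) (nu w0)
    (fun b => [ffun a => nu (lin (mu^-1%g b) a)])
    (fun b => port_map mu (q (mu^-1%g b))) (fun b => delta (mu^-1%g b)).
Proof.
have whE p : port_white (fun b => [ffun a => nu (lin (mu^-1%g b) a)]) (nu w0) (port_map mu p) =
    nu (port_white lin w0 p).
  by case: p => [[b i]|] //=; rewrite ffunE permK.
split.
- move=> b w; transitivity ((mu^-1%g b, nu^-1%g w) \in edges t).
    apply/imsetP/idP => [[[b' w'] bw] [-> ->]|bw]; first by rewrite /= !permK.
    by exists (mu^-1%g b, nu^-1%g w); rewrite //= !permKV.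
  rewrite (frame_edges F); apply: eq_existsb => i.
  by rewrite ffunE -(inj_eq (@perm_inj _ nu)) permKV.
- move=> b; rewrite /cyc ffunE -/(cyc t _) (frame_cyc F).
  apply/setP=> f; apply/imsetP/imsetP => [[g /rotationsP[i gE] ->]|[i _ ->]].
    by exists i => //; apply/ffunP=> a; rewrite !ffunE gE.
  exists [ffun a => lin (mu^-1%g b) (a + i)%R].
    by apply/rotationsP; exists i => a; rewrite ffunE.
  by apply/ffunP=> a; rewrite !ffunE.
- move=> b; rewrite (frame_ranked F); case: (q _) => [[b' i]|] //=.
  by rewrite permK.
- move=> b; rewrite -{1}[b](permKV mu) omap_eq; have := frame_rooted F (mu^-1%g b).
  by case: eqP => [_ ->|_] //; rewrite valid_map.
- move=> p p'; rewrite -[p](port_mapKV mu) -[p'](port_mapKV mu).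
  by rewrite !valid_map !whE => vp vp' /perm_inj E; rewrite (frame_inj F vp vp' E).
- move=> w; have [p vp pw] := frame_surj F (nu^-1%g w).
  by exists (port_map mu p); rewrite ?valid_map // whE pw permKV.
- move=> b; rewrite ffunE (frame_last F) whE -{3}[b](permKV mu) omap_eq.
  by case: eqP.
Qed.

Section Act.
Variable s : 'S_k.+1.
Hypothesis s0 : v = None -> s 0%R = 0%R.

Let tw := twist t (base v w0) w0 #|B| s.

(** The recursion bound #|B| exceeds the depth of every vertex. *)
Lemma twist_rec b : tw b = if q b is Some (b', i) then rho i (tw b') else s.
Proof.
have twS n c : twist t (base v w0) w0 n.+1 s c =
    if q c is Some (b', i) then rho i (twist t (base v w0) w0 n s b') else s.
  rewrite -(frame_graph_port F c) /graph_port /=.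
  by case: pickP => [[w b']|].
have stable c n : delta c < n -> twist t (base v w0) w0 n s c =
    twist t (base v w0) w0 (delta c).+1 s c.
  elim: n c => // n IH c; rewrite ltnS => cn; rewrite !twS.
  have := frame_ranked F c; case: (q c) => [[c' i]|] // dc.
  by rewrite dc IH // -dc.
have lt c := rank_lt (frame_ranked F) c.
rewrite /tw stable // twS; have := frame_ranked F b.
by case: (q b) => [[b' i]|] // ->; rewrite (stable b' #|B|).
Qed.

Lemma twist_0 b : v != Some b -> tw b 0%R = 0%R.
Proof.
move=> vb; rewrite twist_rec; have := frame_rooted F b; rewrite (negPf vb).
case: (q b) => [[b' i]|]; first by rewrite rho_0.
by move=> /eqP /s0.
Qed.

Definition act_root : W :=
  if v is Some x then twisted_linear t (base v w0) w0 s x 0%R else w0.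

(** The subtree in position i at b moves to position [tw b i] at b. *)
Lemma frame_act :
  frame (ct_act t (base v w0) w0 s) v act_root (twisted_linear t (base v w0) w0 s)
    (fun b => if q b is Some (b', i) then Some (b', tw b' i) else None) delta.
Proof.
set lin' := twisted_linear _ _ _ _.
have linE b i : lin' b i = lin b ((tw b)^-1%g i).
  by rewrite ffunE (frame_linear F).
pose twp p := if p is Some (b, i) then Some (b, (tw b)^-1%g i) else None.
have twpV p : valid v (twp p) = valid v p.
  case: p => [[b i]|] //=; have [vb|vb] := eqVneq v (Some b); first by rewrite !orbT.
  by rewrite !orbF -{2}(twist_0 vb) -(inj_eq (@perm_inj _ (tw b))) permKV (twist_0 vb).
have twpE p : valid v p -> port_white lin' act_root p = port_white lin w0 (twp p).
  case: p => [[b i]|] /=; first by rewrite linE.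
  by rewrite /act_root; case: (v).
have twpI : injective twp.
  by move=> [[b i]|] [[b' i']|] //= [-> ] /perm_inj->.
have twq b : twp (if q b is Some (b', i) then Some (b', tw b' i) else None) = q b.
  by case: (q b) => [[b' i]|] //=; rewrite permK.
split.
- move=> b w; rewrite (frame_edges F); apply/existsP/existsP=> -[i /eqP iw].
    by exists (tw b i); rewrite linE permK iw.
  by exists ((tw b)^-1%g i); rewrite -linE iw.
- by move=> b; rewrite /cyc ffunE.
- by move=> b; rewrite (frame_ranked F); case: (q b) => [[b' i]|].
- move=> b; have := frame_rooted F b; case: eqP => [_ ->//|_].
  by rewrite -{1}twq twpV.
- move=> p p' vp vp'; rewrite !twpE // => E; apply: twpI.
  by apply: (frame_inj F) => //; rewrite twpV.
- move=> w; have [p vp pw] := frame_surj F w.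
  pose p' : port k B := if p is Some (b, i) then Some (b, tw b i) else None.
  have pE : twp p' = p by rewrite /p'; case: (p) => [[b i]|] //=; rewrite permK.
  have vp' : valid v p' by rewrite -twpV pE.
  by exists p'; rewrite // twpE ?pE.
- move=> b; have [vb|vb] := eqVneq v (Some b).
    by rewrite /act_root /lin' vb.
  rewrite twpE; last by rewrite -twpV twq; have := frame_rooted F b; rewrite (negPf vb).
  rewrite twq linE -{1}(twist_0 vb) permK (frame_last F) (negPf vb) //.
Qed.

End Act.

Lemma frame_card : #|W| = #|[set p : port k B | valid v p]|.
Proof.
rewrite -[RHS](@card_in_imset _ _ (port_white lin w0)) => [|p p']; last first.
  by rewrite !inE; apply: frame_inj F _ _.
rewrite -cardsT; apply: eq_card => w; rewrite inE; apply/esym/imsetP.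
by have [p vp pw] := frame_surj F w; exists p; rewrite ?inE.
Qed.

(** The white vertices are named by ports, hence an isomorphism of forests
    extends to them. *)
Lemma frame_iso (t' : ctree k B W) v' w0' lin' q' delta' (mu : {perm B}) :
  frame t' v' w0' lin' q' delta' ->
  (forall b, q' (mu b) = port_map mu (q b)) -> v' = omap mu v ->
  exists nu : {perm W}, t' = ct_transport mu nu t /\ w0' = nu w0.
Proof.
move=> F' qq' vv'.
pose f w := port_white lin' w0' (port_map mu (port_of v w0 lin w)).
have fE p : valid v p -> f (port_white lin w0 p) = port_white lin' w0' (port_map mu p).
  by move=> vp; rewrite /f (port_ofE F vp).
have fI : injective f.
  move=> w w'; have [vw <-] := port_ofP F w; have [vw' <-] := port_ofP F w'.
  rewrite !fE // => E; congr port_white; apply: (can_inj (port_mapK mu)).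
  by apply: (frame_inj F') E; rewrite vv' valid_map.
pose nu := perm fI.
have w0E : w0' = nu w0.
  rewrite permE; case ve: v => [x|];
      last by rewrite -[w0 in RHS]/(port_white lin w0 None) fE // ve.
  have vx : valid v (Some (x, 0%R : 'I_k.+1)) by rewrite ve /= eqxx.
  have <- : lin x 0%R = w0 by rewrite (frame_last F) ve eqxx.
  rewrite -[lin x _]/(port_white lin w0 (Some (x, 0%R))) fE //=.
  by rewrite (frame_last F') vv' omap_eq ve eqxx.
have linE b i : lin' (mu b) i = nu (lin b i).
  rewrite permE; have [vi|] := boolP (valid v (Some (b, i))).
    by rewrite -[lin b i]/(port_white lin w0 (Some (b, i))) fE.
  rewrite /= negb_or negbK => /andP[/eqP-> vb].
  rewrite (frame_last F) (frame_last F') vv' omap_eq (negPf vb) qq' fE //.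
  by have := frame_rooted F b; rewrite (negPf vb).
exists nu; split=> //; have T := frame_transport mu nu.
rewrite [t']surjective_pairing [ct_transport _ _ _]surjective_pairing; congr (_, _).
  apply/setP=> -[b w]; rewrite -/(edges t') (frame_edges F').
  rewrite -[(_ \in _)]/((b, w) \in edges (ct_transport mu nu t)) (frame_edges T).
  by apply: eq_existsb => i; rewrite ffunE -{1}[b](permKV mu) linE.
apply/ffunP=> b; rewrite -/(cyc t' b) (frame_cyc F').
rewrite -[RHS]/(cyc (ct_transport mu nu t) b) (frame_cyc T); congr rotations.
by apply/ffunP=> i; rewrite ffunE -{1}[b](permKV mu) linE.
Qed.

End FrameMaps.

Section Ports.
Variables (k : nat) (B : finType) (v : option B).

(** Each black vertex has k valid positions, and there is one more valid port:
    None, or position k+1 at the root black vertex. *)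
Lemma card_valid : #|[set p : port k B | valid v p]| = (#|B| * k).+1.
Proof.
pose f (p : option (B * 'I_k)) : port k B :=
  if p is Some (b, j) then Some (b, lift ord0 j)
  else if v is Some x then Some (x, 0%R) else None.
have nz (x y : B) (j : 'I_k) : (x, lift ord0 j) <> (y, 0%R).
  by move=> E; have := neq_lift ord0 j; rewrite -[lift _ _]/(x, lift ord0 j).2 E eqxx.
have fI : injective f.
  rewrite /f; move=> [[b j]|] [[b' j']|] //.
  - move/Some_inj=> E; have /= -> := congr1 fst E.
    by have /lift_inj-> := congr1 snd E.
  - by case: (v) => // x /Some_inj/nz.
  - by case: (v) => // x /Some_inj/esym/nz.
transitivity #|[set: option (B * 'I_k)]|; last by rewrite cardsT card_option card_prod card_ord.
rewrite -(card_imset _ fI); apply: eq_card => p; rewrite inE; apply/idP/imsetP.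
  case: p => [[b i]|] /= vp.
    case: (unliftP ord0 i) vp => [j ->|->] vp; first by exists (Some (b, j)); rewrite ?finset.inE.
    by move: vp; rewrite /= => /eqP vb; exists None; rewrite ?finset.inE // /f vb.
  by exists None; rewrite ?finset.inE // /f (eqP vp).
case=> -[[b j]|] _ ->; rewrite /f //=.
by case: (v) => [x|] //=; rewrite eqxx.
Qed.

Lemma realise_frame (W : finType) q delta :
  ranked q delta -> rooted v q -> #|W| = (#|B| * k).+1 ->
  exists t w0 lin, @frame k B W t v w0 lin q delta.
Proof.
move=> qra qro; rewrite -card_valid => WE.
have [wd _|W0] := pickP (mem W); last by move: WE; rewrite card_valid eq_card0.
pose A := [set p : port k B | valid v p].
pose c := fiber_match A [set: W] (fun=> tt) (fun=> tt) wd.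
have cE (a : unit) : #|[set x in A | tt == a]| = #|[set y in [set: W] | tt == a]|.
  by case: a; transitivity #|W|; [rewrite WE -/A|]; apply: eq_card => x;
      rewrite !finset.inE ?andbT.
have cI : {in A &, injective c} by apply: fiber_match_inj cE.
pose w0 := if v is Some x then c (Some (x, 0%R)) else c None.
pose lin b : ordering k W := [ffun i => if valid v (Some (b, i)) then c (Some (b, i)) else c (q
    b)].
have whE p : valid v p -> port_white lin w0 p = c p.
  case: p => [[b i]|] vp; first by rewrite /= ffunE vp.
  by move: vp; rewrite /w0 /=; case: (v).
exists ([set e | [exists i, lin e.1 i == e.2]], [ffun b => rotations (lin b)]), w0, lin.
split=> //.
- by move=> b w; rewrite inE.
- by move=> b; rewrite /cyc ffunE.
- by move=> p p' vp vp'; rewrite !whE // => /cI; apply; rewrite inE.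
- move=> w; have : w \in c @: A.
    rewrite (_ : _ @: _ = [set: W]) ?inE //; apply/eqP; rewrite eqEcard finset.subsetT.
    by rewrite cardsT WE card_in_imset /=.
  by case/imsetP=> p; rewrite inE => vp ->; exists p; rewrite ?whE.
move=> b; rewrite ffunE /=; have := qro b; case: eqP => [vb _|_ vq].
  by rewrite /w0 vb.
by rewrite whE.
Qed.

End Ports.

(** * Burnside counting with a twist *)

Section Burnside.
Variables (G : finGroupType) (X U : finType) (to : {action G &-> X}).
Variables (S : {set X}) (V : {set U}) (act : X -> X) (alpha : U -> U) (code : X -> U).
Hypothesis to_S : forall x g, x \in S -> to x g \in S.
Hypothesis code_to : forall x g, x \in S -> code (to x g) = code x.
Hypothesis code_orbit : forall x y, x \in S -> y \in S -> code x = code y ->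
  exists g, y = to x g.
Hypothesis act_S : forall x, x \in S -> act x \in S.
Hypothesis code_act : forall x, x \in S -> code (act x) = alpha (code x).
Hypothesis code_V : forall x, x \in S -> code x \in V.
Hypothesis V_code : forall u, u \in V -> exists2 x, x \in S & code x = u.

(** For y in S, the equation act y = to y g has solutions g only if alpha
    fixes the code of y, and these then form a coset of the stabilizer of y.
    Summing the orders of the stabilizers over an orbit gives |G|. *)
Theorem burnside_twisted :
  \sum_(g : G) #|[set x in S | act (to x g) == x]| =
  #|G| * #|[set u in V | alpha u == u]|.
Proof.
(* Substitute y = to x g. *)
have stepE g : #|[set x in S | act (to x g) == x]| = \sum_(y in S) (act y == to y g^-1%g).
  rewrite -sum1_card (reindex_inj (@act_inj _ _ _ to g^-1%g)) /= [RHS]big_mkcond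
      [LHS]big_mkcond /=.
  apply: eq_bigr => y _; rewrite inE actKV.
  have -> : (to y g^-1%g \in S) = (y \in S).
    apply/idP/idP; last exact: to_S.
    by move/(to_S g); rewrite actKV.
  by case: (y \in S) => //=; case: eqP.
under eq_bigr do rewrite stepE.
rewrite exchange_big /=.
under eq_bigr do rewrite (reindex_inj invg_inj) /=.
pose fiber u := [set y in S | code y == u].
have cnt y : y \in S -> \sum_(g : G) (act y == to y (g^-1)^-1)%g * #|fiber (code y)| =
    (alpha (code y) == code y) * #|G|.
  move=> yS; rewrite -big_distrl /=; case: eqP => [E|E]; last first.
    rewrite big1 // => g _; rewrite invgK; case: eqP => // ag.
    by case: E; rewrite -code_act // ag code_to.
  rewrite mul1n; have [h hE] := code_orbit yS (act_S yS) (esym (etrans (code_act yS) E)).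
  have -> : fiber (code y) = orbit to [set: G] y.
    apply/setP=> z; rewrite inE; apply/andP/orbitP => [[zS /eqP cz]|[g _ <-]].
      by have [g ->] := code_orbit yS zS (esym cz); exists g; rewrite ?inE.
    by rewrite to_S // code_to // eqxx.
  rewrite mulnC -[RHS]cardsT -(card_orbit_stab to [set: G] y); congr (_ * _).
  rewrite -(card_imset _ (mulIg h)) -sum1_card [RHS]big_mkcond.
  apply: eq_bigr => g _; rewrite invgK hE.
  have -> : (g \in [set x * h | x in 'C_[set: G][y | to]])%g = (to y g == to y h).
    apply/imsetP/eqP=> [[x]|E'].
      by rewrite inE => /andP[_ /astab1P xy] ->; rewrite actM xy.
    exists (g * h^-1)%g; last by rewrite mulgKV.
    by rewrite inE inE /=; apply/astab1P; rewrite actM E' actK.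
  by rewrite eq_sym; case: eqP.
transitivity (\sum_(u in V) \sum_(y in fiber u) \sum_(g : G) (act y == to y (g^-1)^-1)%g).
  rewrite (partition_big code (mem V)) //=.
  by apply: eq_bigr => u _; apply: eq_bigl => y; rewrite inE.
rewrite -sum1_card big_distrr /= [RHS]big_mkcond [LHS]big_mkcond /=.
apply: eq_bigr => u _; rewrite inE; case: ifP => //= uV.
have [x xS xu] := V_code uV.
have f0 : 0 < #|fiber u| by apply/card_gt0P; exists x; rewrite inE xS xu eqxx.
apply/eqP; rewrite -(eqn_pmul2r f0) big_distrl /=; apply/eqP.
rewrite (eq_bigr (fun=> (alpha u == u) * #|G|)) => [|y].
  by rewrite sum_nat_const; case: eqP; rewrite ?mul1n ?muln1 ?mul0n ?muln0 // mulnC.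
by rewrite inE => /andP[yS /eqP yu]; rewrite -yu big_distrl cnt.
Qed.
End Burnside.

(** * Coefficients of the generating functions *)

Section Ogf.
Local Open Scope ring_scope.

Lemma sum_cycle_lengths m (mu : 'S_m) :
  (\sum_(1 <= i < m.+1) i * #|[set C in porbits mu | #|C| == i]|)%N = m.
Proof.
transitivity (\sum_(C in porbits mu) #|C|)%N; last first.
  rewrite -[RHS]card_ord -sum1_card (partition_big (porbit mu) (mem (porbits mu))) /=.
    apply: eq_bigr => _ /imsetP[x _ ->]; rewrite -sum1_card; apply: eq_bigl => y.
    by rewrite eq_porbit_mem.
  by move=> x _; apply: imset_f.
transitivity (\sum_(1 <= i < m.+1) \sum_(C in porbits mu | #|C| == i) #|C|)%N.
  apply: eq_bigr => i _; rewrite mulnC -sum_nat_const; apply: eq_big => C; rewrite inE //.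
  by case/andP=> _ /eqP.
rewrite (exchange_big_dep (mem (porbits mu))) /=; last by move=> i C _ /andP[].
apply: eq_bigr => C CP; rewrite (eq_bigl (fun i => i == #|C|)) => [|i]; last first.
  by rewrite CP eq_sym.
rewrite big_nat1_eq; case/imsetP: CP => x _ ->.
by rewrite lt0n card_porbit_neq0 ltnS -[X in (_ <= X)%N]card_ord max_card.
Qed.

Lemma psum_X m (mu : 'S_m) : psum (fun i => 'X^i : {poly rat}) mu = 'X^m.
Proof.
rewrite /psum -[in RHS](sum_cycle_lengths mu) expr_sum.
by apply: eq_bigr => i _; rewrite exprM.
Qed.

Lemma psum_1 (R : comNzRingType) m (mu : 'S_m) : psum (fun=> 1 : R) mu = 1.
Proof. by rewrite /psum big1 // => i _; rewrite expr1n. Qed.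

(** The substitution p_i[x] = x^i turns p_mu[x] into x^m, so only structures
    with m black vertices contribute to the coefficient of x^m. *)
Lemma ogf_count (Gamma : Type) (F : gspecies Gamma) g m n (c : nat) :
  (forall n' : nat, n' != n -> gstr F 'I_m 'I_n' = finset.set0) ->
  (\sum_(h : 'S_m * 'S_n) #|gfix F g h.1 h.2| = #|{: 'S_m * 'S_n}| * c)%N ->
  ogf F g m = c%:R.
Proof.
move=> F0 Fc; rewrite /ogf (@fps_sumE _ _ [:: (m, n)]) //=.
  rewrite big_seq1 /=; rewrite /cycle_index coefZ.
  under eq_bigr do under eq_bigr do rewrite psum_X psum_1 mulr1.
  under eq_bigr do rewrite -mulr_suml.
  rewrite -mulr_suml coefMXn ltnn subnn.
  under eq_bigr do rewrite -natr_sum.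
  rewrite -natr_sum pair_big /= Fc -polyC_natr coefC /=.
  rewrite natrM mulrA card_prod !card_Sn.
  by rewrite natrM mulVf ?mul1r // mulf_neq0 // pnatr_eq0 -lt0n fact_gt0.
move=> [m' n'] _; rewrite inE => ne; rewrite /cycle_index coefZ /=.
under eq_bigr do under eq_bigr do rewrite psum_X psum_1 mulr1.
under eq_bigr do rewrite -mulr_suml.
rewrite -mulr_suml coefMXn; case: ltnP => [_|mm']; first by rewrite mulr0.
have [m'm|m'm] := eqVneq m' m; last first.
  under eq_bigr do rewrite -natr_sum.
  rewrite -natr_sum -polyC_natr coefC subn_eq0 leqNgt ltn_neqAle m'm mm' /=.
  by rewrite mulr0.
subst m'; rewrite big1 ?coef0 ?mulr0 // => mu _; rewrite big1 // => nu _.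
rewrite (_ : gfix _ _ _ _ = finset.set0) ?cards0 //.
apply/setP=> x; rewrite !inE F0 ?inE //.
by apply: contraNneq ne => ->.
Qed.
End Ogf.

(** * Unlabelled structures of the two species *)

Section Species.
Variable k : nat.

Lemma ct_transport1 (B W : finType) (t : ctree k B W) :
  ct_transport 1%g 1%g t = t.
Proof.
rewrite [RHS]surjective_pairing; congr (_, _).
  rewrite -[RHS]imset_id; apply: eq_imset => -[b w] /=; by rewrite !perm1.
apply/ffunP=> b; rewrite ffunE invg1 perm1 /cyc -[RHS]imset_id.
by apply: eq_imset => f; apply/ffunP=> a; rewrite ffunE perm1.
Qed.

Lemma ct_transportM (B W : finType) (mu mu' : {perm B}) (nu nu' : {perm W}) (t : ctree k B W) :
  ct_transport (mu * mu')%g (nu * nu')%g t =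
  ct_transport mu' nu' (ct_transport mu nu t).
Proof.
congr (_, _).
  by rewrite /edges /= -imset_comp; apply: eq_imset => -[b w] /=; rewrite !permM.
apply/ffunP=> b; rewrite /cyc !ffunE /= invMg permM -imset_comp.
by apply: eq_imset => f; apply/ffunP=> a; rewrite !ffunE permM.
Qed.

Lemma frame_root_edge (B W : finType) (t : ctree k B W) x w0 lin q delta :
  frame t (Some x) w0 lin q delta -> (x, w0) \in edges t.
Proof.
move=> F; rewrite (frame_edges F); apply/existsP; exists 0%R.
by rewrite (frame_last F) eqxx.
Qed.

Section Transported.
Variables (N : nat) (B W : finType) (t : ctree k B W) (v : option B) (w0 : W).
Variables (lin : B -> ordering k W) (q : B -> port k B) (delta : B -> nat).
Hypothesis F : frame t v w0 lin q delta.

Lemma graph_port_frame : graph_port t (base v w0) w0 = q.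
Proof. by apply: funext => b; apply: frame_graph_port F b. Qed.

Lemma code_transport (mu : {perm B}) (nu : {perm W}) d p :
  code N (graph_port (ct_transport mu nu t) (base (omap mu v) (nu w0)) (nu w0)) d
    (port_map mu p) = code N (graph_port t (base v w0) w0) d p.
Proof.
have T := frame_transport F mu nu.
have -> : graph_port (ct_transport mu nu t) (base (omap mu v) (nu w0)) (nu w0) =
    fun b => port_map mu (q (mu^-1%g b)).
  by apply: funext => b; apply: frame_graph_port T b.
rewrite graph_port_frame.
have H := @code_embed k N _ _ q (fun b => port_map mu (q (mu^-1%g b))) mu None (@perm_inj _ mu).
have pE (p' : port k B) : port_map mu p' = if p' is Some (b, i) then Some (mu b, i) else None.
  by case: p' => [[]|].
rewrite pE H // => p' b'; rewrite -pE; split=> [E|[b -> <-]]; last by rewrite permK.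
by exists (mu^-1%g b'); rewrite ?permKV //; apply: (can_inj (port_mapK mu)).
Qed.
End Transported.

Definition transportY (m n : nat) (x : ctree k 'I_m 'I_n * 'I_n) (h : 'S_m * 'S_n) :=
  gtransport (g := CTY k) h.1 h.2 x.
Definition transportXY (m n : nat) (x : ctree k 'I_m 'I_n * ('I_m * 'I_n)) (h : 'S_m * 'S_n) :=
  gtransport (g := CTXY k) h.1 h.2 x.

Fact transportY1 m n : (@transportY m n)^~ 1%g =1 id.
Proof. by move=> [t r]; rewrite /transportY /= ct_transport1 perm1. Qed.
Fact transportYM m n x : act_morph (@transportY m n) x.
Proof. by move=> h h'; rewrite /transportY /= ct_transportM permM. Qed.
Fact transportXY1 m n : (@transportXY m n)^~ 1%g =1 id.
Proof. by move=> [t [x w]]; rewrite /transportXY /= ct_transport1 !perm1. Qed.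
Fact transportXYM m n x : act_morph (@transportXY m n) x.
Proof. by move=> h h'; rewrite /transportXY /= ct_transportM !permM. Qed.

Definition actionY m n := TotalAction (@transportY1 m n) (@transportYM m n).
Definition actionXY m n := TotalAction (@transportXY1 m n) (@transportXYM m n).

(** The code classifies the coding trees up to isomorphism, and it carries the
    action on coding trees to the action on unlabelled trees. *)
Theorem ogf_CTY N d (s : 'S_k) m : m <= N -> m <= d ->
  ogf (CTY k) s m = (#|fixed_trees N d s m|%:R)%R.
Proof.
move=> mN md.
have frY n (t : ctree k 'I_m 'I_n) r : is_coding_tree t ->
    exists delta, frame t None r (Defs.linear t (inr r) r) (graph_port t (inr r) r) delta.
  move=> tt; have R x : None = Some x -> (x, r) \in edges t by [].
  exact: (graph_frame tt R).
apply: (@ogf_count _ _ _ _ (m * k).+1) => [n ne|].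
  apply/setP=> -[t r]; rewrite !inE /=; apply: contra_neqF ne => tt.
  have [delta F] := frY n t r tt.
  by have := frame_card F; rewrite card_valid !card_ord.
set n := (m * k).+1.
pose code_of (x : ctree k 'I_m 'I_n * 'I_n) := code N (graph_port x.1 (inr x.2) x.2) d None.
have BN : #|'I_m| <= N by rewrite card_ord.
have lt_d (e : 'I_m -> nat) q : ranked (k := k) q e -> forall b, e b < d.
  by move=> qe b; apply: leq_trans (rank_lt qe b) _; rewrite card_ord.
have -> : fixed_trees N d s m = [set u in [set u : utree k N d | usize u == m] | uact s u == u].
  by apply/setP=> u; rewrite !inE.
transitivity (\sum_(g : 'S_m * 'S_n) #|[set x in gstr (CTY k) 'I_m 'I_n | Defs.gact s (actionY
    m n x g) == x]|).
  by [].
apply: (@burnside_twisted _ _ _ (actionY m n) (gstr (CTY k) 'I_m 'I_n) _ (Defs.gact s) (uact s)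
    code_of).
- move=> [t r] [mu nu]; rewrite !inE /= => /frY-/(_ r)[delta F].
  exact: frame_is_coding_tree (frame_transport F mu nu).
- move=> [t r] [mu nu]; rewrite !inE /= => /frY-/(_ r)[delta F].
  exact: (code_transport N F mu nu d None).
- move=> [t r] [t' r']; rewrite !inE /= => /frY-/(_ r)[e F] /frY-/(_ r')[e' F'] E.
  have [mu [muE _]] := @code_iso k N _ _ _ e e' None None d BN (frame_ranked F) (frame_ranked F')
    (frame_rooted F) (frame_rooted F') (lt_d _ _ (frame_ranked F)) (lt_d _ _ (frame_ranked F')) E.
  by have [nu [-> ->]] := frame_iso F F' muE erefl; exists (mu, nu).
- move=> [t r]; rewrite !inE /= => /frY-/(_ r)[e F].
  by apply: (frame_is_coding_tree (frame_act F _)) => _; apply: embed0.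
- move=> [t r]; rewrite !inE /= => /frY-/(_ r)[e F].
  have A := @frame_act _ _ _ _ _ _ _ _ _ F (embed s) (fun _ => embed0 s).
  rewrite /code_of /=; rewrite /= in A.
  have -> := graph_port_frame A.
  apply: (@code_twist k N 'I_m _ _ (twist t (inr r) r #|'I_m| (embed s))) => //.
  + by move=> b b' i qb; rewrite (twist_rec F) // qb.
  + by move=> b; case: (graph_port t (inr r) r b) => [[]|].
  + by move=> b qb; rewrite (twist_rec F) // qb.
- move=> [t r]; rewrite !inE /= => /frY-/(_ r)[e F].
  rewrite /code_of /= (usize_root BN (frame_ranked F) (frame_rooted F)) ?card_ord //.
  exact: lt_d (frame_ranked F).
move=> u; rewrite inE => /eqP um; have [q [e [qe qr qc]]] := realiseY um.
have [|t [w0 [lin F]]] := @realise_frame _ _ None 'I_n q e qe qr; first by rewrite !card_ord.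
exists (t, w0); first by rewrite inE; apply: frame_is_coding_tree F.
by rewrite /code_of /= -[inr w0]/(base None w0) (graph_port_frame F).
Qed.

Definition fixed_tuples N d (s : 'S_k.+1) m : {set {ffun 'I_k.+1 -> utree k N d}} :=
  [set a | ((tuple_size a).+1 == m) && (tuple_act id s s a == a)].

(** The code of an edge-rooted tree is the (k+1)-tuple of codes around its
    root black vertex. Position k+1 is included, and the action may move any
    white vertex to it. *)
Theorem ogf_CTXY N d (s : 'S_k.+1) m : m <= N -> m <= d ->
  ogf (CTXY k) s m = (#|fixed_tuples N d s m|%:R)%R.
Proof.
move=> mN md.
have frXY n (t : ctree k 'I_m 'I_n) x w : is_coding_tree t && ((x, w) \in edges t) ->
    exists delta, frame t (Some x) w (Defs.linear t (inl x) w) (graph_port t (inl x) w) delta.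
  move=> /andP[tt xw]; have R y : Some x = Some y -> (y, w) \in edges t by case=> <-.
  exact: (graph_frame tt R).
apply: (@ogf_count _ _ _ _ (m * k).+1) => [n ne|].
  apply/setP=> -[t [x w]]; rewrite !inE /=; apply: contra_neqF ne => tt.
  have [delta F] := frXY _ _ _ _ tt.
  by have := frame_card F; rewrite card_valid !card_ord.
set n := (m * k).+1.
pose code_of (x : ctree k 'I_m 'I_n * ('I_m * 'I_n)) :=
  tuple_code N (graph_port x.1 (inl x.2.1) x.2.2) id d x.2.1.
have BN : #|'I_m| <= N by rewrite card_ord.
have lt_d (e : 'I_m -> nat) q : ranked (k := k) q e -> forall b, e b < d.
  by move=> qe b; apply: leq_trans (rank_lt qe b) _; rewrite card_ord.
have -> : fixed_tuples N d s m = [set a in [set a : {ffun 'I_k.+1 -> utree k N d} | (tuple_size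
    a).+1 == m] |
    tuple_act id s s a == a].
  by apply/setP=> u; rewrite !inE.
apply: (@burnside_twisted _ _ _ (actionXY m n) (gstr (CTXY k) 'I_m 'I_n) _ (Defs.gact s)
  (tuple_act id s s) code_of).
- move=> [t [x w]] [mu nu]; rewrite !inE /= => /frXY[delta F].
  have T := frame_transport F mu nu.
  by rewrite (frame_is_coding_tree T) (frame_root_edge T).
- move=> [t [x w]] [mu nu]; rewrite !inE /= => /frXY[delta F].
  apply/ffunP=> i; rewrite !ffunE; exact: (code_transport N F mu nu d (Some (x, i))).
- move=> [t [x w]] [t' [x' w']]; rewrite !inE /= => /frXY[e F] /frXY[e' F'] E.
  have [mu [muE [xE]]] := @code_iso k N _ _ _ e e' (Some x) (Some x') d BN (frame_ranked F)
      (frame_ranked F')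
    (frame_rooted F) (frame_rooted F') (lt_d _ _ (frame_ranked F)) (lt_d _ _ (frame_ranked F')) E.
  by have [|nu [-> ->]] := frame_iso F F' muE; [rewrite xE|exists (mu, nu); rewrite xE].
- move=> [t [x w]]; rewrite !inE /= => /frXY[e F].
  have sN : Some x = None -> s 0%R = 0%R by [].
  have A := frame_act F sN.
  by rewrite (frame_is_coding_tree A) (frame_root_edge A).
- move=> [t [x w]]; rewrite !inE /= => /frXY[e F].
  have sN : Some x = None -> s 0%R = 0%R by [].
  have A := frame_act F sN.
  rewrite /code_of /=; rewrite /= in A.
  have -> := graph_port_frame A.
  have twx : twist t (inl x) w #|'I_m| s x = s.
    by rewrite (twist_rec F) //; have := frame_rooted F x; rewrite eqxx => ->.
  rewrite -[in RHS](_ : twist t (inl x) w #|'I_m| s x = s) //.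
  apply: (@tuple_code_twist k N 'I_m _ _ (twist t (inl x) w #|'I_m| s)) => //.
  by move=> b b' i qb; rewrite (twist_rec F) // qb.
- move=> [t [x w]]; rewrite !inE /= => /frXY[e F].
  rewrite /code_of /= (tuple_size_root BN (frame_ranked F) (frame_rooted F)) ?card_ord //.
  exact: lt_d (frame_ranked F).
move=> u; rewrite inE => /eqP um; have [q [e [x [qe qr qc]]]] := realiseXY um.
have [|t [w0 [lin F]]] := @realise_frame _ _ (Some x) 'I_n q e qe qr; first by rewrite !card_ord.
exists (t, (x, w0)).
  by rewrite inE /= (frame_is_coding_tree F) (frame_root_edge F).
by rewrite /code_of /= -[inl x]/(base (Some x) w0) (graph_port_frame F).
Qed.

End Species.

(** * The functional equations *)

Section Assembly.
Local Open Scope ring_scope.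
Variable k : nat.

Definition fixed_poly N d (s : 'S_k) (e : nat) : {poly rat} :=
  \sum_(u : utree k N d | uact s u == u) 'X^(e * usize u)%N.

Lemma coef_fixed_poly N d s e i : (0 < e)%N ->
  (fixed_poly N d s e)`_i = if (e %| i)%N then #|fixed_trees N d s (i %/ e)%N|%:R else 0.
Proof.
move=> e0; rewrite coef_sum.
under eq_bigr do rewrite coefXn.
rewrite -natr_sum; case: ifP => ei.
  congr (_%:R); rewrite -sum1_card [RHS]big_mkcond [LHS]big_mkcond /=.
  apply: eq_bigr => u _;
      rewrite inE andbC -[usize u == _](eqn_pmul2l e0) [(e * (i %/ e))%N]mulnC divnK //.
  by rewrite [i == _]eq_sym; do 2!case: (_ == _).
rewrite big1 // => u _; case: eqP => // E.
by rewrite E dvdn_mulr in ei.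
Qed.

Lemma fixed_poly_conj N d s s' e : (0 < e)%N -> ncycles s =1 ncycles s' ->
  fixed_poly N d s e = fixed_poly N d s' e.
Proof.
move=> e0 E; apply/polyP=> i; rewrite !coef_fixed_poly //.
by rewrite (fixed_trees_conj N d _ E).
Qed.

Lemma fixed_poly_dilate N d s e i : (0 < e)%N -> (i <= N)%N -> (i <= d)%N ->
  (fixed_poly N d s e)`_i = fps_dilate e (ogf (CTY k) s) i.
Proof.
move=> e0 iN id_; rewrite coef_fixed_poly // /fps_dilate; case: ifP => // ei.
have le : (i %/ e <= i)%N by apply: leq_div.
by rewrite (@ogf_CTY k N d) // (leq_trans le).
Qed.

(** The permutation rep l stands for any permutation of the cycle type of
    rho_i(s^l), as fixed trees are counted by cycle type. *)
Lemma sum_fixed_tuples N d (I : finType) (ports : I -> 'I_k.+1) (pi : {perm I})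
    (s : 'S_k.+1) (rep : nat -> 'S_k) e (i0 : I) :
  (forall i, s (ports i) = ports (pi i)) -> (0 < e)%N ->
  (forall i l, (pi ^+ l)%g i = i -> l = #|porbit pi i| ->
     ncycles (subrho (ports i) (s ^+ l)%g) =1 ncycles (rep l)) ->
  \sum_(a : {ffun I -> utree k N d} | tuple_act ports pi s a == a) 'X^(e * tuple_size a)%N =
  \prod_(C in porbits pi) fixed_poly N d (rep #|C|) (e * #|C|)%N :> {poly rat}.
Proof.
move=> sP e0 repP.
pose r (C : {set I}) := odflt i0 [pick x in C].
have rP C : C \in porbits pi -> r C \in C.
  case/imsetP=> x _ ->; rewrite /r; case: pickP => //= H.
  by have := H x; rewrite porbit_id.
pose u0 : utree k N d := code N (fun _ : void => None) d None.
rewrite (eq_bigl (is_fixed_tuple pi (fun i => @uact k N d (subrho (ports i) s)))); last first.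
  by move=> a; exact: tuple_act_fixed.
under eq_bigr do rewrite exprM.
rewrite (@cycle_product _ _ pi _ (@usize k N d) _ r u0 rP); last first.
  by move=> i u; rewrite usize_uact.
apply: eq_bigr => C CP.
have lC : (0 < #|C|)%N by case/imsetP: CP => i _ ->; rewrite lt0n card_porbit_neq0.
rewrite -(@fixed_poly_conj N d (subrho (ports (r C)) (s ^+ #|C|)%g)) ?muln_gt0 ?e0 //; last first.
  by apply: repP; [exact: rep_cycle|rewrite rep_porbit].
rewrite /fixed_poly; apply: eq_big => u; first by rewrite around_uact.
by rewrite -exprM mulnA.
Qed.

Lemma prod_cycle_type j (s : 'S_j) (f : nat -> {poly rat}) :
  \prod_(i <- cycle_type s) f i = \prod_(C in porbits s) f #|C|.
Proof.
rewrite /cycle_type (perm_big _ (permEl (perm_sort _ _))) /= big_map.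
by rewrite big_enum.
Qed.

Lemma cycle_type_gt0 j (s : 'S_j) i : i \in cycle_type s -> (0 < i)%N.
Proof.
rewrite mem_sort => /mapP[C]; rewrite mem_enum => /imsetP[x _ ->] ->.
by rewrite lt0n card_porbit_neq0.
Qed.

Lemma coef_sum_Xn (T : finType) (P : pred T) (f : T -> nat) j :
  (\sum_(a | P a) 'X^(f a) : {poly rat})`_j = #|[set a | P a && (f a == j)]|%:R.
Proof.
rewrite coef_sum; under eq_bigr do rewrite coefXn.
rewrite -natr_sum -sum1_card [in RHS]big_mkcond [in LHS]big_mkcond /=.
congr (_%:R); apply: eq_bigr => a _; rewrite inE eq_sym.
by case: (P a) => //=; case: (_ == _).
Qed.

Lemma ncycles_subrho_embed (s : 'S_k) (j : 'I_k) :
  s j = j -> ncycles (subrho (lift ord0 j) (embed s)) =1 ncycles s.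
Proof.
move=> sj n; apply/eqP; rewrite -(eqn_add2l (n == 1%N)) -ncycles_subrho.
  by rewrite ncycles_embed.
by rewrite embed_lift sj.
Qed.

(** The coefficient of x^i in the n-th term of the exponent: the k-tuples
    fixed by s^n are counted with x^n marking black vertices, and the shift
    accounts for the black vertex that carries the tuple. *)
Lemma coef_tuplesY (s : 'S_k) (rep : nat -> 'S_k) m n i : (0 < k)%N -> (0 < n)%N -> (i <= m)%N ->
  (forall j, cycle_type (rep j) = cycle_type (s ^+ j)%g) ->
  fps_shift n (\big[fps_mul/fps_one]_(l <- cycle_type (s ^+ n)%g)
      fps_dilate (n * l) (ogf (CTY k) (rep (n * l)%N))) i =
  #|[set a : {ffun 'I_k -> utree k m m} |
       (black_act (s ^+ n)%g a == a) && (n * (tuple_size a).+1 == i)%N]|%:R.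
Proof.
move=> k0 n0 im repE; rewrite /fps_shift; case: ifPn => [ni|ni]; last first.
  rewrite (_ : [set _ | _] = finset.set0) ?cards0 //; apply/setP=> a; rewrite !inE.
  by apply/negP=> /andP[_ /eqP E]; case/negP: ni; rewrite -E leq_pmulr.
rewrite -(@fps_prod_coef m _ _ _ (fun l => fixed_poly m m (rep (n * l)%N) (n * l)%N));
    last 2 first.
- move=> l j lin jm; rewrite fixed_poly_dilate // muln_gt0 n0; exact: cycle_type_gt0 lin.
- exact: leq_trans (leq_subr _ _) im.
rewrite prod_cycle_type.
rewrite -(@sum_fixed_tuples m m _ (lift ord0) _ (embed (s ^+ n)%g) (fun l => rep (n * l)%N) n
    (Ordinal k0)) //.
- rewrite coef_sum_Xn; congr (_%:R); apply: eq_card => a; rewrite !inE.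
  by congr (_ && _); rewrite mulnS -(eqn_add2l n) subnKC.
- by move=> j; rewrite embed_lift.
move=> j l lj _ c; rewrite -embedX ncycles_subrho_embed // -expgM.
by rewrite -!count_cycle_type repE.
Qed.

(** Up to the coefficient of x^m both sides only involve trees with at most m
    black vertices, for which depth m + 1 and multiplicities m suffice. *)
Theorem ogfY_exp (s : 'S_k) (rep : nat -> 'S_k) : (0 < k)%N ->
  (forall j, cycle_type (rep j) = cycle_type (s ^+ j)%g) ->
  ogf (CTY k) s =1
    fps_exp (fps_sum [set n : nat | (1 <= n)%N]%classic (fun n =>
      fps_scale (n%:R^-1) (fps_shift n
        (\big[fps_mul/fps_one]_(i <- cycle_type (s ^+ n)%g)
           fps_dilate (n * i) (ogf (CTY k) (rep (n * i)%N)))))).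
Proof.
move=> k0 repE; apply: fps_exp_unique.
- rewrite (@fps_sumE _ _ [::]) ?big_nil // => n /= n0 _.
  by rewrite /fps_scale /fps_shift leqNgt n0 mulr0.
- rewrite (@ogf_CTY k 0 0) // (_ : #|fixed_trees 0 0 s 0| = 1%N) //.
  by rewrite -card_unit; apply: eq_card => u; rewrite !inE; case: u.
move=> m; rewrite (@ogf_CTY k m m.+1) // -natrM fixed_trees_rec // natr_sum.
apply: eq_big_nat => i /andP[i1 im]; rewrite natrM mulrC (@ogf_CTY k m m.+1) ?leq_subr //;
    last first.
  by apply: leq_trans (leq_subr _ _) _.
congr (_ * _); rewrite (@fps_sumE _ _ (index_iota 1 m.+1)) ?iota_uniq //; last 2 first.
- by move=> n; rewrite mem_index_iota => /andP[].
- move=> n /= n1; rewrite mem_index_iota n1 /= -leqNgt => mn.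
  by rewrite /fps_scale /fps_shift leqNgt (leq_ltn_trans _ mn) // mulr0.
rewrite natr_sum mulr_sumr; apply: eq_big_nat => n /andP[n1 _].
rewrite /fps_scale (@coef_tuplesY _ _ m) // mulrA.
rewrite (eq_bigr (fun=> i %/ n)%N) => [|a /andP[_ /eqP <-]]; last by rewrite mulKn.
rewrite sum_nat_const natrM mulrC.
have [ni|ni] := boolP (n %| i)%N.
  rewrite natf_div ?pnatr_eq0 -?lt0n //; congr (_ * _%:R).
  by apply: eq_card => a; rewrite !inE.
rewrite [X in _ * X%:R](_ : _ = 0%N) ?mulr0; last first.
  apply/eqP; rewrite cards_eq0; apply/eqP/setP=> a; rewrite !inE.
  by apply/negP=> /andP[_ /eqP E]; rewrite -E dvdn_mulr in ni.
rewrite [X in _ * X%:R](_ : _ = 0%N) ?mulr0 //.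
apply: eq_card0 => a; rewrite inE.
by apply/negP=> /andP[_ /eqP E]; rewrite -E dvdn_mulr in ni.
Qed.

Theorem ogfXY_prod (s : 'S_k.+1) (rep : nat -> 'S_k) :
  (forall i, i \in cycle_type s ->
     cycle_type (rep i) = rem 1%N (cycle_type (s ^+ i)%g)) ->
  ogf (CTXY k) s =1
    fps_shift 1 (\big[fps_mul/fps_one]_(i <- cycle_type s)
      fps_dilate i (ogf (CTY k) (rep i))).
Proof.
move=> repE m; rewrite (@ogf_CTXY k m m) // /fps_shift.
case: m => [|m] /=.
  by rewrite eq_card0 // => a; rewrite !inE.
rewrite subn1 /= -(@fps_prod_coef m.+1 _ _ _ (fun l => fixed_poly m.+1 m.+1 (rep l) l));
    last 2 first.
- by move=> l j /cycle_type_gt0 l0 jm; rewrite fixed_poly_dilate.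
- exact: leqnSn.
(* The permutations rep l are only specified for the parts l of the type. *)
have H := @sum_fixed_tuples m.+1 m.+1 _ id s s
  (fun l => if l \in cycle_type s then rep l else 1%g) 1 ord0.
rewrite prod_cycle_type.
transitivity ((\sum_(a : {ffun 'I_k.+1 -> utree k m.+1 m.+1} | tuple_act id s s a == a)
    'X^(1 * tuple_size a)%N : {poly rat})`_m).
  rewrite coef_sum_Xn; congr (_%:R); apply: eq_card => a; rewrite !inE.
  by rewrite mul1n eqSS andbC.
have inC C : C \in porbits s -> #|C| \in cycle_type s.
  by move=> CP; rewrite mem_sort; apply: map_f; rewrite mem_enum.
rewrite H //.
  rewrite (eq_bigr (fun C : {set 'I_k.+1} => fixed_poly m.+1 m.+1 (rep #|C|) #|C|)) // => C CP.
  by rewrite inC // mul1n.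
move=> i l li lE; have lc : l \in cycle_type s by rewrite lE inC // imset_f.
rewrite lc => n; have := count_cycle_type (rep l) n.
rewrite repE // count_mem_rem count_cycle_type (ncycles_subrho n li) => <-.
by rewrite eq_sym addnC addnK.
Qed.
End Assembly.

Theorem corollary6p2 (k : nat) (hk : (1 <= k)%N) :
  (* s is any permutation of cycle type la, and rep j is any permutation of
     cycle type la^j *)
  (forall (la : seq nat) (s : 'S_k) (rep : nat -> 'S_k),
      is_partition k la ->
      cycle_type s = la ->
      (forall j : nat, cycle_type (rep j) = cycle_type (s ^+ j)%g) ->
      ogf (CTY k) s =1
        fps_exp (fps_sum [set n : nat | (1 <= n)%N]%classic (fun n =>
          fps_scale (n%:R^-1)%R (fps_shift n
            (\big[fps_mul/fps_one]_(i <- cycle_type (s ^+ n)%g)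
               fps_dilate (n * i) (ogf (CTY k) (rep (n * i)%N)))))))
  /\
  (* s is any permutation of cycle type la, and rep i is any permutation of
     cycle type la^i - {1} *)
  (forall (la : seq nat) (s : 'S_k.+1) (rep : nat -> 'S_k),
      is_partition k.+1 la ->
      cycle_type s = la ->
      (forall i : nat, i \in la ->
         cycle_type (rep i) = rem 1%N (cycle_type (s ^+ i)%g)) ->
      ogf (CTXY k) s =1
        fps_shift 1 (\big[fps_mul/fps_one]_(i <- la)
          fps_dilate i (ogf (CTY k) (rep i)))).
Proof.
split=> la s rep _ E repE; first exact: ogfY_exp.
by subst la; apply: ogfXY_prod.
Qed.
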